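(* Let $X$ and $Y$ be non-zero Banach spaces over $\mathbb K\in\{\mathbb R,\mathbb C\}$ and let $N=2^m$ with $m\ge1$ an integer. Then $$C_{\mathrm{NJ}}(X\widehat\otimes_{\varepsilon}Y)\ge\max\left\{C_{\mathrm{NJ}}(X),\,C_{\mathrm{NJ}}(Y),\,2\bigl(\eta_N(X)\eta_N(Y)\bigr)^{-2/m}\right\},$$ $$C_{\mathrm{NJ}}(X\widehat\otimes_{\pi}Y)\ge\max\left\{C_{\mathrm{NJ}}(X),\,C_{\mathrm{NJ}}(Y),\,2\bigl(\eta_N(X^* )\eta_N(Y^* )\bigr)^{-2/m}\right\},$$ where, if one of the indices $\eta_N$ appearing in the last term is infinite, that last term is interpreted as $0$. For $N=2$ these last terms are $2/(\eta_2(X)^2\eta_2(Y)^2)$ and $2/(\eta_2(X^* )^2\eta_2(Y^* )^2)$, respectively.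
   Context: For a Banach space $X$, the von Neumann--Jordan constant is $$C_{\mathrm{NJ}}(X)=\sup\left\{\frac{\|x+y\|^{2}+\|x-y\|^{2}}{2(\|x\|^{2}+\|y\|^{2})}: x,y\in X,\ (x,y)\neq(0,0)\right\}.$$ For Banach spaces $X,Y$ over $\mathbb K$, and $w=\sum_{j=1}^r x_j\otimes y_j$ in the algebraic tensor product $X\otimes Y$, the injective norm is $\|w\|_\varepsilon=\sup\{|\sum_{j} x^*(x_j)y^*(y_j)|: x^*\in B_{X^*},\,y^*\in B_{Y^*}\}$ and the projective norm is $\|w\|_\pi=\inf\{\sum_{j}\|x_j\|\|y_j\|: w=\sum_{j} x_j\otimes y_j\}$. The completions of $X\otimes Y$ for these norms are denoted $X\widehat\otimes_\varepsilon Y$ and $X\widehat\otimes_\pi Y$. $d(E,F)=\inf\{\|T\|\|T^{-1}\|: T:E\to F\text{ a linear isomorphism}\}$ is the Banach--Mazur distance and $\ell_2^d$ is $\mathbb K^d$ with the Euclidean norm. For $d\ge2$, $$\eta_d(X)=\inf\{d(E,\ell_2^d): E\subset X,\ \dim E=d\},$$ with $\eta_d(X)=\infty$ if $X$ contains no $d$-dimensional subspace. *)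

(* Defs.v *)
From HB Require Import structures.
From mathcomp Require Import all_boot all_order all_algebra.
From mathcomp Require Import generic_quotient complex.
From mathcomp Require Import all_classical all_reals all_analysis.

Set Implicit Arguments.
Unset Strict Implicit.
Unset Printing Implicit Defensive.

Import Order.TTheory GRing.Theory Num.Theory.
Import numFieldNormedType.Exports.

Local Open Scope classical_set_scope.
Local Open Scope ring_scope.
Local Open Scope quotient_scope.

(* The scalar field is R or R[i].  MathComp norms over K take values in K (on
   the nonnegative real axis); [re] brings them back to R. *)
Variant scalar_field (R : realType) : forall K : numFieldType, (K -> R) -> Prop :=
| RealScalars : @scalar_field R R id
| ComplexScalars : @scalar_field R (R[i] : numFieldType) (@complex.Re R).

Definition rnorm (R : realType) (K : numFieldType) (re : K -> R)
  (V : normedModType K) (x : V) : R := re `|x|.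

Definition euclidean_norm (R : realType) (K : numFieldType) (re : K -> R)
  (d : nat) (v : 'rV[K]_d) : R := Num.sqrt (\sum_(i < d) re `|v ord0 i| ^+ 2).

Definition CNJ (R : realType) (K : numFieldType) (re : K -> R)
  (V : normedModType K) : \bar R :=
  ereal_sup [set r | exists x y : V, (x, y) != (0, 0) /\
    r = ((rnorm re (x + y) ^+ 2 + rnorm re (x - y) ^+ 2)
         / (2 * (rnorm re x ^+ 2 + rnorm re y ^+ 2)))%:E].

(* A norm is passed as an explicit real-valued function on a vector space, so
   that the same definitions apply to a Banach space, its dual and ell_2^d. *)

Section NormGeometry.
Context {R : realType} {K : numFieldType}.

Definition has_dim (V : lmodType K) (d : nat) (E : set V) : Prop :=
  exists b : 'I_d -> V,
    (forall c : 'I_d -> K, \sum_(i < d) c i *: b i = 0 -> forall i, c i = 0) /\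
    E = [set \sum_(i < d) c i *: b i | c in [set: 'I_d -> K]].

Definition opnorm (V W : lmodType K) (nV : V -> R) (nW : W -> R)
  (E : set V) (T : V -> W) : \bar R :=
  ereal_sup [set (nW (T x))%:E | x in [set x | E x /\ nV x <= 1]].

(* Only the values of T on E and of S on F matter; S is the inverse of T. *)
Definition linear_iso (V W : lmodType K) (E : set V) (F : set W)
  (T : V -> W) (S : W -> V) : Prop :=
  [/\ forall a x y, E x -> E y -> T (a *: x + y) = a *: T x + T y,
      forall x, E x -> F (T x) /\ S (T x) = x
    & forall y, F y -> E (S y) /\ T (S y) = y].

Definition banach_mazur (V W : lmodType K) (nV : V -> R) (nW : W -> R)
  (E : set V) (F : set W) : \bar R :=
  ereal_inf [set r | exists T S, linear_iso E F T S /\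
    r = (opnorm nV nW E T * opnorm nW nV F S)%E].

(* The value is +oo when V has no d-dimensional subspace. *)
Definition eta_norm (re : K -> R) (V : lmodType K) (nV : V -> R) (d : nat) :
    \bar R :=
  ereal_inf [set banach_mazur nV (@euclidean_norm R K re d) E setT
            | E in [set E : set V | has_dim d E]].

Definition eta_term (m : nat) (a b : \bar R) : \bar R :=
  if (a == +oo%E) || (b == +oo%E) then 0%E
  else (2 * (fine a * fine b) `^ (- (2 / m%:R)))%:E.

Definition eta (re : K -> R) (V : normedModType K) (d : nat) : \bar R :=
  eta_norm re (@rnorm R K re V) d.

Definition is_completion (V : lmodType K) (nV : V -> \bar R) (re : K -> R)
  (Z : completeNormedModType K) (i : {linear V -> Z}) : Prop :=
  (forall w, (rnorm re (i w))%:E = nV w) /\ dense (range i).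

End NormGeometry.

Section Dual.
Context {K : numFieldType} (X : normedModType K).

Definition dual_pred : {pred X -> K^o} :=
  fun f => `[< linear f /\ continuous f >].

Lemma dual_submod_closed : submod_closed dual_pred.
Proof.
split=> [|a f g /asboolP[lf cf] /asboolP[lg cg]]; apply/asboolP; split.
- by move=> b x y; rewrite /= [RHS]addr0 scaler0.
- by move=> x; exact: cvg_cst.
- move=> b x y; rewrite !fctE lf lg !scalerDr !scalerA (mulrC a).
  by rewrite -!addrA; congr (_ + _); rewrite addrCA.
- by move=> x; apply: cvgD; [apply: cvgZl_tmp; exact: cf|exact: cg].
Qed.

HB.instance Definition _ :=
  GRing.isSubmodClosed.Build K (X -> K^o) dual_pred dual_submod_closed.

Record dual := Dual { dual_fun :> X -> K^o ; _ : dual_fun \in dual_pred }.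

HB.instance Definition _ := [isSub for dual_fun].
HB.instance Definition _ := [Choice of dual by <:].
HB.instance Definition _ := [SubChoice_isSubLmodule of dual by <:].

End Dual.

Definition dual_norm (R : realType) (K : numFieldType) (re : K -> R)
  (X : normedModType K) (f : dual X) : R :=
  sup [set re `|f x| | x in [set x : X | rnorm re x <= 1]].

Definition eta_dual (R : realType) (K : numFieldType) (re : K -> R)
  (X : normedModType K) (d : nat) : \bar R :=
  eta_norm re (@dual_norm R K re X) d.

Section Tensor.
Context {K : numFieldType} (X Y : lmodType K).

(* The list [:: (x_1, y_1); ...; (x_r, y_r)] stands for the formal sum of the
   x_j (x) y_j, concatenation being addition; X (x) Y is the quotient of these
   formal sums by the bilinearity relations. *)
Inductive tensor_eq : seq (X * Y) -> seq (X * Y) -> Prop :=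
| teq_refl s : tensor_eq s s
| teq_sym s t : tensor_eq s t -> tensor_eq t s
| teq_trans s t u : tensor_eq s t -> tensor_eq t u -> tensor_eq s u
| teq_cat s s' t t' :
    tensor_eq s s' -> tensor_eq t t' -> tensor_eq (s ++ t) (s' ++ t')
| teq_catC s t : tensor_eq (s ++ t) (t ++ s)
| teq_0 y : tensor_eq [:: (0, y)] [::]
| teq_Dl x x' y : tensor_eq [:: (x + x', y)] [:: (x, y); (x', y)]
| teq_Dr x y y' : tensor_eq [:: (x, y + y')] [:: (x, y); (x, y')]
| teq_Z a x y : tensor_eq [:: (a *: x, y)] [:: (x, a *: y)].

Definition tensor_rel : rel (seq (X * Y)) := fun s t => `[< tensor_eq s t >].

Lemma tensor_rel_refl : reflexive tensor_rel.
Proof. by move=> s; apply/asboolP; exact: teq_refl. Qed.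

Lemma tensor_rel_sym : symmetric tensor_rel.
Proof. by move=> s t; apply/asboolP/asboolP; exact: teq_sym. Qed.

Lemma tensor_rel_trans : transitive tensor_rel.
Proof.
by move=> t s u /asboolP st /asboolP tu; apply/asboolP; exact: teq_trans st tu.
Qed.

Canonical tensor_equiv :=
  EquivRel tensor_rel tensor_rel_refl tensor_rel_sym tensor_rel_trans.

Definition tensor := {eq_quot tensor_rel}.
HB.instance Definition _ := Choice.on tensor.
HB.instance Definition _ := EqQuotient.on tensor.

Definition tensor_class (s : seq (X * Y)) : tensor := \pi s.

Lemma tensor_classP (s t : seq (X * Y)) :
  tensor_class s = tensor_class t <-> tensor_eq s t.
Proof. by split=> [/eqquotP/asboolP|?]; last exact/eqquotP/asboolP. Qed.

Lemma tensor_classK (u : tensor) : tensor_class (repr u) = u.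
Proof. exact: reprK. Qed.

Lemma tensorP (u : tensor) : exists s, u = tensor_class s.
Proof. by exists (repr u); rewrite tensor_classK. Qed.

Lemma tensor_repr s : tensor_eq (repr (tensor_class s)) s.
Proof. by apply/tensor_classP; rewrite tensor_classK. Qed.

Definition formal_scale (a : K) (s : seq (X * Y)) :=
  [seq (a *: p.1, p.2) | p <- s].

Definition tensor_zero : tensor := tensor_class [::].
Definition tensor_add (u v : tensor) : tensor := tensor_class (repr u ++ repr v).
Definition tensor_scale (a : K) (u : tensor) : tensor :=
  tensor_class (formal_scale a (repr u)).
Definition tensor_opp (u : tensor) : tensor := tensor_scale (- 1) u.

Lemma formal_scale_eq a s t :
  tensor_eq s t -> tensor_eq (formal_scale a s) (formal_scale a t).
Proof.
elim=> {s t}.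
- by move=> s; exact: teq_refl.
- by move=> s t _; exact: teq_sym.
- by move=> s t u _ st _; exact: teq_trans.
- by move=> s s' t t' _ ss' _ tt'; rewrite /formal_scale !map_cat; exact: teq_cat.
- by move=> s t; rewrite /formal_scale !map_cat; exact: teq_catC.
- by move=> y; rewrite /formal_scale /= scaler0; exact: teq_0.
- by move=> x x' y; rewrite /formal_scale /= scalerDr; exact: teq_Dl.
- by move=> x y y'; exact: teq_Dr.
- by move=> b x y; rewrite /formal_scale /= scalerA mulrC -scalerA; exact: teq_Z.
Qed.

Lemma tensor_addE s t :
  tensor_add (tensor_class s) (tensor_class t) = tensor_class (s ++ t).
Proof. by apply/tensor_classP/teq_cat; exact: tensor_repr. Qed.

Lemma tensor_scaleE a s :
  tensor_scale a (tensor_class s) = tensor_class (formal_scale a s).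
Proof. exact/tensor_classP/formal_scale_eq/tensor_repr. Qed.

Lemma formal_scaleD a b s :
  tensor_eq (formal_scale (a + b) s) (formal_scale a s ++ formal_scale b s).
Proof.
elim: s => [|[x y] s IH] /=; first exact: teq_refl.
rewrite -cat1s scalerDl.
apply: teq_trans (teq_cat (teq_Dl _ _ _) IH) _ => /=.
rewrite -[X in tensor_eq X _]cat1s -[X in tensor_eq _ X]cat1s.
apply: teq_cat (teq_refl _) _.
rewrite -[X in tensor_eq X _]cat1s -[X in tensor_eq _ (_ ++ X)]cat1s !catA.
by apply: teq_cat (teq_refl _); exact: teq_catC.
Qed.

Lemma formal_scale0 s : tensor_eq (formal_scale 0 s) [::].
Proof.
elim: s => [|[x y] s IH] /=; first exact: teq_refl.
by rewrite scale0r -cat1s -[[::]]cats0; apply: teq_cat IH; exact: teq_0.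
Qed.

Lemma formal_scale1 s : formal_scale 1 s = s.
Proof. by elim: s => [//|[x y] s /= ->]; rewrite scale1r. Qed.

Lemma tensor_addA : associative tensor_add.
Proof.
move=> u v w; have [s ->] := tensorP u; have [t ->] := tensorP v.
have [r ->] := tensorP w.
by rewrite (tensor_addE t r) (tensor_addE s t) !tensor_addE catA.
Qed.

Lemma tensor_addC : commutative tensor_add.
Proof.
move=> u v; have [s ->] := tensorP u; have [t ->] := tensorP v.
by rewrite !tensor_addE; exact/tensor_classP/teq_catC.
Qed.

Lemma tensor_add0 : left_id tensor_zero tensor_add.
Proof. by move=> u; have [s ->] := tensorP u; rewrite tensor_addE. Qed.

Lemma tensor_addN : left_inverse tensor_zero tensor_opp tensor_add.
Proof.
move=> u; have [s ->] := tensorP u.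
rewrite /tensor_opp tensor_scaleE tensor_addE; apply/tensor_classP.
rewrite -{2}[s]formal_scale1; apply: teq_trans (teq_sym (formal_scaleD _ _ _)) _.
by rewrite addNr; exact: formal_scale0.
Qed.

HB.instance Definition _ :=
  GRing.isZmodule.Build tensor tensor_addA tensor_addC tensor_add0 tensor_addN.

Lemma tensor_scaleA a b (u : tensor) :
  tensor_scale a (tensor_scale b u) = tensor_scale (a * b) u.
Proof.
have [s ->] := tensorP u; rewrite (tensor_scaleE b) !tensor_scaleE.
congr tensor_class; rewrite /formal_scale -map_comp.
by apply: eq_map => p /=; rewrite scalerA.
Qed.

Lemma tensor_scale1 : left_id 1 tensor_scale.
Proof.
by move=> u; have [s ->] := tensorP u; rewrite tensor_scaleE formal_scale1.
Qed.

Lemma tensor_scaleDr : right_distributive tensor_scale +%R.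
Proof.
move=> a u v; have [s ->] := tensorP u; have [t ->] := tensorP v.
change (tensor_scale a (tensor_add (tensor_class s) (tensor_class t)) =
  tensor_add (tensor_scale a (tensor_class s)) (tensor_scale a (tensor_class t))).
rewrite (tensor_addE s) !(tensor_scaleE a) tensor_addE.
by rewrite /formal_scale map_cat.
Qed.

Lemma tensor_scaleDl (u : tensor) :
  {morph tensor_scale^~ u : a b / a + b >-> a + b}.
Proof.
move=> a b; have [s ->] := tensorP u.
change (tensor_scale (a + b) (tensor_class s) =
  tensor_add (tensor_scale a (tensor_class s)) (tensor_scale b (tensor_class s))).
rewrite (tensor_scaleE (a + b)) (tensor_scaleE a) (tensor_scaleE b) tensor_addE.
exact/tensor_classP/formal_scaleD.
Qed.

HB.instance Definition _ := GRing.Zmodule_isLmodule.Build K tensor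
  tensor_scaleA tensor_scale1 tensor_scaleDr tensor_scaleDl.

Definition tens (x : X) (y : Y) : tensor := tensor_class [:: (x, y)].

Definition tens_sum (s : seq (X * Y)) : tensor := \sum_(p <- s) tens p.1 p.2.

End Tensor.

Section TensorNorms.
Context {R : realType} {K : numFieldType} (re : K -> R) (X Y : normedModType K).

(* The inner sum depends only on w, not on the representation s. *)
Definition injective_norm (w : tensor X Y) : \bar R :=
  ereal_sup [set r | exists (s : seq (X * Y)) (f : dual X) (g : dual Y),
    [/\ w = tens_sum s, dual_norm re f <= 1, dual_norm re g <= 1
      & r = (re `|\sum_(p <- s) f p.1 * g p.2|)%:E]].

Definition projective_norm (w : tensor X Y) : \bar R :=
  ereal_inf [set (\sum_(p <- s) rnorm re p.1 * rnorm re p.2)%:E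
            | s in [set s : seq (X * Y) | w = tens_sum s]].

End TensorNorms.

(* Main.v *)
From HB Require Import structures.
Require Import Defs.
From mathcomp Require Import all_boot all_order all_algebra.
From mathcomp Require Import complex ring lra.
From mathcomp Require Import all_classical all_reals all_analysis.

(** The von Neumann-Jordan constant C of a normed space is the best constant in
    the parallelogram inequality
      |x + y|^2 + |x - y|^2 <= 2 C (|x|^2 + |y|^2).
    Both tensor norms are cross norms, |x (x) y| = |x| |y|: for the injective
    norm, and for the lower bound in the projective one, this is the existence
    of norming functionals (norming_functional), that is, the Hahn-Banach
    theorem. Hence x |-> x (x) y0 and y |-> x0 (x) y are, up to a factor,
    isometric embeddings of X and Y in the tensor product, which yields the
    bounds by the constants of X and Y.

    For the last term, iterate the parallelogram inequality m times: with H the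
    Walsh matrix of order N = 2^m (entries +1 and -1, and H^2 = N),
      sum_k |sum_j H_kj u_j|^2 <= (2 C)^m sum_j |u_j|^2
    for all vectors u_j (walsh_parallelogram). A subspace of dimension N whose
    Banach-Mazur distance to ell_2^N is nearly eta_N carries a system e_j with
      |sum_j c_j e_j| <= s |c|_2   and   1 <= t |e_j|,
    where t s is nearly eta_N (banach_mazur_frame).

    Injective norm: given systems e_j in X and e'_j in Y with constants (s, t)
    and (s', t'), put w_k = sum_j H_kj e_j (x) e'_j. A functional of norm 1 on X
    takes on (e_j) values whose ell_2 norm is at most s, so |w_k| <= s s' by the
    Cauchy-Schwarz inequality, while sum_k H_lk w_k = N e_l (x) e'_l has norm at
    least N / (t t'). The Walsh inequality then gives 2^m <= C^m (t s t' s')^2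
    (injective_frame_bound).

    Projective norm: the systems f_j, g_j now live in the dual spaces, and the
    argument is dualized. The bilinear forms b_k = sum_l H_kl f_l (x) g_l are
    bounded by s s' on the projective tensor product. Choose x_j, y_j in the unit
    balls where f_j and g_j nearly attain their norms, and test b_k against
    sum_j H_kj x_j (x) y_j: summing over k, orthogonality of H leaves N^2 times
    about 1 / (t t'), and the Walsh inequality bounds the same sum from above.
    The resulting inequality is again 2^m <= C^m (t s t' s')^2
    (projective_frame_bound).

    Passing to the infimum over all systems turns this into
    C >= 2 (eta_N eta_N)^(-2/m). *)

Set Implicit Arguments.
Unset Strict Implicit.
Unset Printing Implicit Defensive.

Import Order.TTheory GRing.Theory Num.Theory.
Import numFieldNormedType.Exports.
Local Open Scope classical_set_scope.
Local Open Scope ring_scope.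

(** * Real and complex scalars *)

(** The real and the complex case are treated together through the embedding
    iota of the reals in K: [re] is only ever applied to nonnegative elements of
    K, where it inverts iota. *)
Definition real_part (R : realType) (K : numFieldType) (re : K -> R)
    (iota : {rmorphism R -> K}) : Prop :=
  {mono iota : x y / x <= y} /\ forall z, 0 <= z -> iota (re z) = z.

Lemma scalar_field_real_part (R : realType) (K : numFieldType) (re : K -> R) :
  scalar_field re -> exists iota : {rmorphism R -> K}, real_part re iota.
Proof.
move=> hK; case: K re / hK.
  by exists [the {rmorphism R -> R} of idfun].
exists (real_complex R); split => [x y|]; first by rewrite lecR.
by move=> [a b]; rewrite lecE /= => /andP[/eqP -> _].
Qed.

Section Scalars.
Context {R : realType} {K : numFieldType} {re : K -> R}.
Variable iota : {rmorphism R -> K}.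
Hypothesis hre : real_part re iota.

Local Notation abs z := (re `|z|).

Lemma iota_abs (z : K) : iota (abs z) = `|z|.
Proof. exact: hre.2. Qed.

Lemma ler_iota (a b : R) : (iota a <= iota b) = (a <= b).
Proof. exact: hre.1. Qed.

Lemma iota_ge0 (a : R) : (0 <= iota a) = (0 <= a).
Proof. by rewrite -(rmorph0 iota) ler_iota. Qed.

Lemma iota_inj : injective iota.
Proof. exact: fmorph_inj. Qed.

Lemma re_iota (a : R) : 0 <= a -> re (iota a) = a.
Proof. by move=> a0; apply: iota_inj; rewrite hre.2 // iota_ge0. Qed.

Lemma le_re (x y : K) : 0 <= x -> x <= y -> re x <= re y.
Proof.
by move=> x0 xy; rewrite -ler_iota !hre.2 //; exact: le_trans xy.
Qed.

Lemma reD (x y : K) : 0 <= x -> 0 <= y -> re (x + y) = re x + re y.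
Proof.
by move=> x0 y0; apply: iota_inj; rewrite rmorphD /= !hre.2 // addr_ge0.
Qed.

Lemma reM (x y : K) : 0 <= x -> 0 <= y -> re (x * y) = re x * re y.
Proof.
by move=> x0 y0; apply: iota_inj; rewrite rmorphM /= !hre.2 // mulr_ge0.
Qed.

Lemma re_ge0 (x : K) : 0 <= x -> 0 <= re x.
Proof. by move=> x0; rewrite -iota_ge0 hre.2. Qed.

Lemma re0 : re 0 = 0.
Proof. by rewrite -(rmorph0 iota) re_iota. Qed.

Lemma abs_iota (a : R) : 0 <= a -> abs (iota a) = a.
Proof. by move=> a0; rewrite ger0_norm ?iota_ge0 // re_iota. Qed.

Lemma abs_ge0 (z : K) : 0 <= abs z.
Proof. exact: re_ge0. Qed.

Lemma absM (z w : K) : abs (z * w) = abs z * abs w.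
Proof. by rewrite normrM reM. Qed.

Lemma absD (z w : K) : abs (z + w) <= abs z + abs w.
Proof. by rewrite -reD // le_re // ler_normD. Qed.

Lemma abs_eq0 (z : K) : (abs z == 0) = (z == 0).
Proof. by rewrite -(inj_eq iota_inj) iota_abs rmorph0 normr_eq0. Qed.

Lemma abs0 : abs (0 : K) = 0. Proof. by rewrite normr0 re0. Qed.

Lemma abs_sign n : abs ((-1) ^+ n : K) = 1.
Proof. by rewrite normr_sign -(rmorph1 iota) re_iota. Qed.

Lemma abs_sum I (r : seq I) (F : I -> K) :
  abs (\sum_(i <- r) F i) <= \sum_(i <- r) abs (F i).
Proof.
elim/big_ind2: _ => [|x a y b xa yb|//]; first by rewrite abs0.
exact: le_trans (absD _ _) (lerD xa yb).
Qed.

Section Norm.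
Context {V : normedModType K}.
Implicit Types x y : V.

Lemma rnorm_ge0 x : 0 <= rnorm re x.
Proof. exact: re_ge0. Qed.

Lemma rnormZ a x : rnorm re (a *: x) = abs a * rnorm re x.
Proof. by rewrite /rnorm normrZ reM. Qed.

Lemma rnormD x y : rnorm re (x + y) <= rnorm re x + rnorm re y.
Proof. by rewrite /rnorm -reD // le_re // ler_normD. Qed.

Lemma rnorm_eq0 x : (rnorm re x == 0) = (x == 0).
Proof. by rewrite -(inj_eq iota_inj) /rnorm hre.2 // rmorph0 normr_eq0. Qed.

Lemma rnorm_gt0 x : (0 < rnorm re x) = (x != 0).
Proof. by rewrite lt0r rnorm_ge0 rnorm_eq0 andbT. Qed.

Lemma rnorm0 : rnorm re (0 : V) = 0.
Proof. by apply/eqP; rewrite rnorm_eq0. Qed.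

End Norm.
End Scalars.

(** * The Hahn-Banach theorem *)

Section HahnBanach.
Context {R : realType} {K : numFieldType} {iota : {rmorphism R -> K}}.
Context {V : lmodType K}.
Implicit Types (p q : V -> R) (x y : V).

(** Only real scalars, acting through iota, are taken out of q, so that real
    functionals on complex spaces are covered. *)
Definition sublinear q : Prop :=
  (forall x y, q (x + y) <= q x + q y) /\
  (forall t x, 0 <= t -> q (iota t *: x) = t * q x).

Lemma sublinearI q : (forall x y, q (x + y) <= q x + q y) -> q 0 = 0 ->
  (forall t x, 0 < t -> q (iota t *: x) <= t * q x) -> sublinear q.
Proof.
move=> qD q0 qZ; split=> // t x; rewrite le0r => /orP[/eqP ->|t0].
  by rewrite rmorph0 scale0r mul0r.
apply/eqP; rewrite eq_le qZ //= -ler_pdivlMl //.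
have := qZ _ (iota t *: x) (eq_ind_r is_true t0 (invr_gt0 t)).
by rewrite scalerA -rmorphM /= mulVf ?gt_eqF // rmorph1 scale1r.
Qed.

Section Sublinear.
Variable q : V -> R.
Hypothesis hq : sublinear q.

Lemma sublinear0 : q 0 = 0.
Proof. by rewrite -(scale0r 0) -(rmorph0 iota) hq.2 // mul0r. Qed.

Lemma sublinear_ge x : - q (- x) <= q x.
Proof. by rewrite lerNl -subr_ge0 opprK addrC -sublinear0 -(subrr x) hq.1. Qed.

(** This sublinear functional lies below q and takes at - y a value of at most
    - q y. A minimal q is therefore equal to all its slope infima, which makes it
    additive; applied to p and x0 before the minimization, the construction
    forces a functional below it to agree with p at x0. *)
Definition slope_inf y x : R :=
  inf [set q (x + iota t *: y) - t * q y | t in [set t | 0 <= t]].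

Lemma slope_inf_le y x t : 0 <= t ->
  slope_inf y x <= q (x + iota t *: y) - t * q y.
Proof.
move=> t0; apply: ge_inf; last by exists t.
exists (- q (- x)) => _ [s /= s0 <-].
rewrite lerBrDr addrC -hq.2 // lerBlDr.
by apply: le_trans (hq.1 _ _); rewrite addrAC subrr add0r.
Qed.

Lemma le_slope_inf y x b :
  (forall t, 0 <= t -> b <= q (x + iota t *: y) - t * q y) ->
  b <= slope_inf y x.
Proof.
move=> hb; apply: lb_le_inf => [|_ [t /= t0 <-]]; last exact: hb.
by exists (q (x + iota 0 *: y) - 0 * q y), 0 => /=.
Qed.

Lemma slope_inf_le_self y x : slope_inf y x <= q x.
Proof.
by have := slope_inf_le y x (lexx 0); rewrite rmorph0 scale0r addr0 mul0r subr0.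
Qed.

Lemma slope_inf_sublinear y : sublinear (slope_inf y).
Proof.
apply: sublinearI => [x z||a x a0].
- rewrite -lerBlDl; apply: le_slope_inf => t t0; rewrite lerBlDl -lerBlDr.
  apply: le_slope_inf => s s0; rewrite lerBlDr.
  apply: le_trans (slope_inf_le _ _ (addr_ge0 s0 t0)) _.
  rewrite rmorphD /= scalerDl addrACA mulrDl opprD [leRHS]addrACA.
  by rewrite lerD2r hq.1.
- apply/eqP; rewrite eq_le -{1}sublinear0 slope_inf_le_self /=.
  by apply: le_slope_inf => t t0; rewrite add0r hq.2 // subrr.
- rewrite -ler_pdivrMl //; apply: le_slope_inf => t t0.
  rewrite ler_pdivrMl // mulrBr -(hq.2 _ (x + _)) ?(ltW a0) // mulrA scalerDr scalerA -rmorphM.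
  by apply: slope_inf_le; rewrite mulr_ge0 // ltW.
Qed.

End Sublinear.

(** Given two members of a chain, the smaller one bounds both, so subadditivity
    of the members passes to the infimum. *)
Lemma chain_inf_sublinear (A : set (V -> R)) (b : V -> R) : A !=set0 ->
  (forall q, A q -> sublinear q) -> (forall q x, A q -> b x <= q x) ->
  (forall q r, A q -> A r -> (forall x, q x <= r x) \/ (forall x, r x <= q x)) ->
  sublinear (fun x => inf [set q x | q in A]).
Proof.
move=> [q0 Aq0] Asub Alb Atot; pose i x := inf [set q x | q in A].
have iA x q : A q -> i x <= q x.
  by move=> Aq; apply: ge_inf; [exists (b x) => _ [r Ar <-]; exact: Alb|exists q].
have lei x c : (forall q, A q -> c <= q x) -> c <= i x.
  move=> cA; apply: lb_le_inf => [|_ [q Aq <-]]; last exact: cA.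
  by exists (q0 x), q0.
apply: sublinearI => [x y||a x a0]; rewrite -/(i _).
- rewrite -lerBlDl; apply: (lei) => q Aq; rewrite lerBlDl -lerBlDr.
  apply: lei => r Ar; rewrite lerBlDr.
  have [qr|rq] := Atot _ _ Aq Ar.
    by apply: le_trans (iA _ _ Aq) (le_trans ((Asub _ Aq).1 _ _) _); rewrite lerD2r.
  by apply: le_trans (iA _ _ Ar) (le_trans ((Asub _ Ar).1 _ _) _); rewrite lerD2l.
- apply/eqP; rewrite eq_le -{1}(sublinear0 (Asub _ Aq0)) iA //=.
  by apply: (lei) => q Aq; rewrite (sublinear0 (Asub _ Aq)).
- rewrite -/(i x) -ler_pdivrMl //; apply: (lei) => q Aq.
  by rewrite ler_pdivrMl // -(Asub _ Aq).2 ?(ltW a0) // iA.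
Qed.

(** Zorn's lemma for the order opposite to the pointwise one; p itself bounds the
    empty chain. *)
Lemma minimal_sublinear p : sublinear p -> exists f, [/\ sublinear f,
  forall x, f x <= p x &
  forall q, sublinear q -> (forall x, q x <= f x) -> q = f].
Proof.
move=> hp; pose T := {q | sublinear q /\ forall x, q x <= p x}.
pose rel (q r : T) := `[< forall x, sval r x <= sval q x >].
have [|||| [f [hf fp]] fmin] := @Zorn T rel.
- by move=> q; apply/asboolP => x.
- by move=> q r s /asboolP qr /asboolP rs; apply/asboolP => x; exact: le_trans (qr x).
- move=> [q hq] [r hr] /asboolP /= qr /asboolP /= rq; apply: eq_exist => /=.
  by apply: funext => x; apply/eqP; rewrite eq_le qr rq.
- move=> A Atot; have [[q0 Aq0]|A0] := pselect (A !=set0); last first.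
    exists (exist _ p (conj hp (fun x => lexx _))) => s As.
    by exfalso; apply: A0; exists s.
  pose B := [set sval q | q in A].
  have Bp (q : V -> R) x : B q -> - p (- x) <= q x.
    move=> [r Ar <-]; have [hr rp] := svalP r.
    by apply: le_trans (sublinear_ge hr _); rewrite lerN2.
  have hi : sublinear (fun x => inf [set q x | q in B]).
    apply: (@chain_inf_sublinear _ (fun x => - p (- x))) => //.
    - by exists (sval q0), q0.
    - by move=> _ [r Ar <-]; exact: (svalP r).1.
    - move=> _ _ [q Aq <-] [r Ar <-].
      by have [/asboolP|/asboolP] := Atot _ _ Aq Ar; [right|left].
  have iB x (q : T) : A q -> inf [set q x | q in B] <= sval q x.
    move=> Aq; apply: ge_inf; last by exists (sval q) => //; exists q.
    by exists (- p (- x)) => _ [r Br <-]; exact: Bp.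
  have ip x : inf [set q x | q in B] <= p x.
    exact: le_trans (iB _ _ Aq0) ((svalP q0).2 x).
  by exists (exist _ (fun x => inf [set q x | q in B]) (conj hi ip)) => s As; apply/asboolP => x; exact: iB.
exists f; split => // q hq qf.
have qp x : q x <= p x by exact: le_trans (qf x) (fp x).
have /fmin/(congr1 sval) // : rel (exist _ f (conj hf fp)) (exist _ q (conj hq qp)).
exact/asboolP.
Qed.

(** A minimal sublinear functional below the slope infimum of p at x0 is linear:
    for everywhere defined functionals, the comparison with slope infima takes the
    place of the usual one-dimensional extension step. *)
Lemma hahn_banach p x0 : sublinear p -> exists f : V -> R, [/\
  forall x y, f (x + y) = f x + f y,
  forall t x, f (iota t *: x) = t * f x,
  forall x, f x <= p x & f x0 = p x0].
Proof.
move=> hp.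
have [f [hf fp fmin]] := minimal_sublinear (slope_inf_sublinear hp x0).
have fD x y : f (x + y) = f x + f y.
  apply/eqP; rewrite eq_le hf.1 /=.
  have := slope_inf_le hf y x ler01; rewrite rmorph1 scale1r mul1r.
  by rewrite (fmin _ (slope_inf_sublinear hf y) (slope_inf_le_self hf y)) lerBrDr.
have fN x : f (- x) = - f x.
  by apply/eqP; rewrite -addr_eq0 addrC -fD subrr sublinear0.
have {}fp' x : f x <= p x := le_trans (fp x) (slope_inf_le_self hp _ _).
exists f; split=> // [t x|].
  have [t0|t0] := leP 0 t; first exact: hf.2.
  rewrite -[t]opprK rmorphN /= scaleNr fN hf.2 ?mulNr //.
  by rewrite oppr_ge0 ltW.
apply/eqP; rewrite eq_le fp' /= -lerN2 -fN.
apply: le_trans (fp _) _.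
have := slope_inf_le hp x0 (- x0) ler01.
by rewrite rmorph1 scale1r addNr mul1r sublinear0 // sub0r.
Qed.

End HahnBanach.
Arguments sublinear {R K} iota {V} q.

Section ComplexScalars.
Local Open Scope complex_scope.

(** The Bohnenblust-Sobczyk argument: a real functional f dominated by p is the
    real part of the complex functional g x = f x - i f (i x), and rotating x so
    that g x becomes a nonnegative real transfers the bound from f to g. *)
Lemma complex_sublinear_dominated (R : realType) (V : lmodType R[i])
    (p : V -> R) (x0 : V) :
  (forall x y, p (x + y) <= p x + p y) ->
  (forall a x, p (a *: x) = complex.Re `|a| * p x) ->
  exists g : V -> R[i], [/\ forall a x y, g (a *: x + y) = a * g x + g y,
    forall x, complex.Re `|g x| <= p x & p x0 <= complex.Re `|g x0|].
Proof.
move=> pD pZ; have hp : sublinear (real_complex R) p.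
  by split=> // t x t0; rewrite pZ ger0_norm // lecR.
have [f [fD fZ fp fx0]] := hahn_banach x0 hp.
pose g x : R[i] := (f x) +i* (- f ('i%C *: x)).
have fN x : f (- x) = - f x.
  by have := fZ (- 1) x; rewrite rmorphN rmorph1 scaleN1r mulN1r.
have gD x y : g (x + y) = g x + g y.
  by rewrite /g scalerDr !fD opprD.
have gZ a x : g (a *: x) = a * g x.
  case: a => u v.
  have split_scale (z : V) : (u +i* v)%C *: z = u%:C%C *: z + v%:C%C *: ('i%C *: z).
    rewrite scalerA -scalerDl; congr (_ *: _).
    by apply/eqP; rewrite eq_complex /=; apply/andP; split; apply/eqP; ring.
  rewrite /g [in 'i%C *: _]scalerA mulrC -scalerA !split_scale !fD !fZ scalerA.
  have -> : ('i * 'i = -1 :> R[i])%C.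
    by apply/eqP; rewrite eq_complex /=; apply/andP; split; apply/eqP; ring.
  rewrite scaleN1r fN.
  by apply/eqP; rewrite eq_complex /=; apply/andP; split; apply/eqP; ring.
exists g; split=> [a x y|x|]; first by rewrite gD gZ.
  have [->|gx0] := eqVneq (g x) 0.
    have := sublinear_ge hp x; rewrite -scaleN1r pZ normrN1 mul1r normr0 /=.
    lra.
  pose c := `|g x| / g x.
  have -> : complex.Re `|g x| = f (c *: x).
    have -> : `|g x| = g (c *: x) by rewrite gZ /c divfK.
    by [].
  apply: le_trans (fp _) _; rewrite pZ.
  by rewrite /c normrM normfV normr_id divff ?normr_eq0 //= mul1r.
rewrite -fx0.
have := normc_ge_Re (g x0); rewrite lecE /= => /andP[_]; apply: le_trans.
exact: ler_norm.
Qed.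

End ComplexScalars.

(** * Dual spaces *)

Section DualFacts.
Context {R : realType} {K : numFieldType} {re : K -> R}.
Variable iota : {rmorphism R -> K}.
Hypothesis hre : real_part re iota.
Context {X : normedModType K}.
Implicit Types (f g : dual X) (x y : X).

Local Notation abs z := (re `|z|).

Lemma dual_linear f : linear f.
Proof. by case: f => f /= /asboolP[]. Qed.

Lemma dual_continuous f : continuous f.
Proof. by case: f => f /= /asboolP[]. Qed.

HB.instance Definition _ f :=
  GRing.isLinear.Build K X K^o *:%R (dual_fun f) (dual_linear f).

Lemma dual_funZ a f x : (a *: f) x = a * f x.
Proof. by []. Qed.

Lemma dual_fun_sum I (r : seq I) (F : I -> dual X) x :
  (\sum_(i <- r) F i : dual X) x = \sum_(i <- r) F i x.
Proof. by elim/big_rec2: _ => // i y1 y2 _ <-. Qed.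

Lemma bounded_linear_dual (g : X -> K^o) (M : R) : linear g ->
  (forall x, abs (g x) <= M * rnorm re x) ->
  exists f : dual X, dual_fun f = g.
Proof.
move=> lg gM; pose G : {linear X -> K^o} := HB.pack g (GRing.isLinear.Build _ _ _ _ _ lg).
have cg : continuous G.
  apply: bounded_linear_continuous; apply/bounded_funP => r.
  exists (iota (`|M| * re `|r|)) => x xr.
  rewrite -(iota_abs hre) (ler_iota hre) (le_trans (gM _)) //.
  rewrite (le_trans (ler_wpM2r (rnorm_ge0 hre _) (ler_norm M))) // ler_wpM2l //.
  by rewrite (le_re hre) // ger0_norm // (le_trans _ xr).
suff gP : g \in @dual_pred K X by exists (Dual gP).
by apply/asboolP.
Qed.

Lemma dual_has_sup f :
  has_sup [set abs (f x) | x in [set x : X | rnorm re x <= 1]].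
Proof.
split; first by exists (abs (f 0)), 0 => //=; rewrite (rnorm0 hre).
have /linear_boundedP/pinfty_ex_gt0[M M0 fM] :
    bounded_near [the {linear X -> K^o} of dual_fun f] (nbhs (0 : X)).
  exact/linear_bounded_continuous/dual_continuous.
exists (re M) => _ [x /= x1 <-].
rewrite -(ler_iota hre) (iota_abs hre) hre.2 ?(ltW M0) //.
apply: le_trans (fM x) _; rewrite ler_piMr ?(ltW M0) //.
by rewrite -(hre.2 `|x|) // -(rmorph1 iota) (ler_iota hre).
Qed.

Lemma dual_norm_le f M :
  (forall x, rnorm re x <= 1 -> abs (f x) <= M) -> dual_norm re f <= M.
Proof.
move=> fM; apply: ge_sup; first by have [] := dual_has_sup f.
by move=> _ [x /= x1 <-]; exact: fM.
Qed.

Lemma le_dual_norm_ball f x : rnorm re x <= 1 -> abs (f x) <= dual_norm re f.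
Proof. by move=> x1; apply: ub_le_sup; [have [] := dual_has_sup f|exists x]. Qed.

Lemma dual_norm_ge0 f : 0 <= dual_norm re f.
Proof.
by apply: le_trans (abs_ge0 hre (f 0)) (@le_dual_norm_ball f 0 _); rewrite (rnorm0 hre).
Qed.

Lemma le_dual_norm f x : abs (f x) <= dual_norm re f * rnorm re x.
Proof.
have [->|x0] := eqVneq x 0.
  by rewrite linear0 (abs0 hre) mulr_ge0 ?dual_norm_ge0 ?(rnorm_ge0 hre).
have r0 : 0 < rnorm re x by rewrite (rnorm_gt0 hre).
rewrite -ler_pdivrMr // mulrC.
have := @le_dual_norm_ball f (iota (rnorm re x)^-1 *: x).
rewrite linearZ (rnormZ hre) (absM hre) (abs_iota hre) ?invr_ge0 ?(ltW r0) //.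
by rewrite mulVf ?gt_eqF // => /(_ (lexx _)).
Qed.

Lemma dual_normZ a f : dual_norm re (a *: f) = abs a * dual_norm re f.
Proof.
have ub b (h : dual X) : dual_norm re (b *: h) <= abs b * dual_norm re h.
  apply: dual_norm_le => x x1.
  by rewrite dual_funZ (absM hre) ler_wpM2l ?(abs_ge0 hre) // le_dual_norm_ball.
apply/eqP; rewrite eq_le ub /=.
have [->|a0] := eqVneq a 0; first by rewrite (abs0 hre) mul0r dual_norm_ge0.
have aa0 : 0 < abs a by rewrite lt0r (abs_eq0 hre) // a0 (abs_ge0 hre).
rewrite -ler_pdivlMl // -{1}[f](scalerK a0) (le_trans (ub _ _)) //.
by rewrite -(ler_pM2l aa0) mulrA -(absM hre) mulfV // mulVKf ?gt_eqF //
  -(rmorph1 iota) (abs_iota hre) // mul1r.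
Qed.

Lemma dual_norm_eq0 f : dual_norm re f = 0 -> f = 0.
Proof.
move=> f0; apply/val_inj/funext => x /=; apply/eqP; rewrite -(abs_eq0 hre).
by rewrite eq_le (abs_ge0 hre) andbT (le_trans (le_dual_norm f x)) // f0 mul0r.
Qed.

(** Values below the norm are attained exactly, and by a nonnegative real: scale
    and rotate a point of the ball where the functional is larger. *)
Lemma dual_norm_attained_below f (c : R) : 0 <= c -> c < dual_norm re f ->
  exists2 x, rnorm re x <= 1 & f x = iota c.
Proof.
move=> c0 /(sup_gt (dual_has_sup f).1) [_ [x /= x1 <-] cx].
have fx0 : f x != 0 by rewrite -(abs_eq0 hre) gt_eqF // (le_lt_trans c0).
exists ((iota c / f x) *: x); last by rewrite linearZ /=; exact: divfK.
have fxp : 0 < abs (f x) by rewrite (le_lt_trans c0).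
rewrite (rnormZ hre) (le_trans _ x1) // ler_piMl ?(rnorm_ge0 hre) //.
rewrite -(ler_pM2r fxp) -(absM hre) divfK // mul1r (abs_iota hre) //.
exact: ltW.
Qed.

End DualFacts.

Lemma norming_functional (R : realType) (K : numFieldType) (re : K -> R)
    (X : normedModType K) (x0 : X) : scalar_field re ->
  exists2 f : dual X, dual_norm re f <= 1 & re `|f x0| = rnorm re x0.
Proof.
move=> hK; have [iota hre] := scalar_field_real_part hK.
suff [g [lg gle gx0]] : exists g : X -> K^o, [/\ linear g,
    forall x, re `|g x| <= rnorm re x & rnorm re x0 <= re `|g x0|].
  have [|f fg] := @bounded_linear_dual _ _ _ _ hre X g 1 lg.
    by move=> x; rewrite mul1r.
  exists f; last by apply/eqP; rewrite fg eq_le gle gx0.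
  by apply: (dual_norm_le hre) => x; apply: le_trans; rewrite fg.
case: K re / hK X x0 iota hre => [|] X x0 iota hre.
- have hp : sublinear (idfun : {rmorphism R -> R}) (@rnorm R R id X).
    split=> [x y|t x t0]; first exact: (rnormD hre).
    by rewrite (rnormZ hre) ger0_norm.
  have [f [fD fZ fp fx0]] := hahn_banach x0 hp.
  have fN x : f (- x) = - f x.
    by have := fZ (- 1) x; rewrite /= scaleN1r mulN1r.
  exists f; split=> [a x y|x|]; first by rewrite fD fZ.
    by rewrite /= ler_norml fp andbT lerNl -fN (le_trans (fp _)) // /rnorm normrN.
  by rewrite -fx0 ler_norm.
- apply: (@complex_sublinear_dominated R X); first exact: (rnormD hre).
  exact: (rnormZ hre).
Qed.

(** * The algebraic tensor product and its norms *)

Section TensorAlgebra.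
Context {K : numFieldType} {X Y : lmodType K}.
Implicit Types (x : X) (y : Y) (s t : seq (X * Y)).

Lemma tens_sumE s : tens_sum s = tensor_class s.
Proof.
elim: s => [|[x y] s IH]; first by rewrite /tens_sum big_nil.
by rewrite /tens_sum big_cons -/(tens_sum s) IH; exact: tensor_addE.
Qed.

Lemma tens_sum1 x y : tens_sum [:: (x, y)] = tens x y.
Proof. exact: tens_sumE. Qed.

Lemma tensDl x x' y : tens (x + x') y = tens x y + tens x' y.
Proof.
rewrite [RHS](tensor_addE [:: (x, y)] [:: (x', y)]).
exact/tensor_classP/teq_Dl.
Qed.

Lemma tensDr x y y' : tens x (y + y') = tens x y + tens x y'.
Proof.
rewrite [RHS](tensor_addE [:: (x, y)] [:: (x, y')]).
exact/tensor_classP/teq_Dr.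
Qed.

Lemma tensZl a x y : tens (a *: x) y = a *: tens x y.
Proof. by rewrite [RHS](tensor_scaleE a [:: (x, y)]). Qed.

Lemma tensZr a x y : tens x (a *: y) = a *: tens x y.
Proof. by rewrite -tensZl; apply/esym/tensor_classP/teq_Z. Qed.

(** The relations that a map must respect to factor through the tensor product. *)
Definition balanced (W : zmodType) (b : X -> Y -> W) : Prop :=
  [/\ forall x x' y, b (x + x') y = b x y + b x' y,
      forall x y y', b x (y + y') = b x y + b x y'
    & forall a x y, b (a *: x) y = b x (a *: y)].

Lemma balanced_sum_eq (W : zmodType) (b : X -> Y -> W) s t :
  balanced b -> tens_sum s = tens_sum t ->
  \sum_(p <- s) b p.1 p.2 = \sum_(p <- t) b p.1 p.2.
Proof.
case=> bDl bDr bZ; rewrite !tens_sumE => /tensor_classP.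
elim=> {s t} [//|//|s t u _ -> _ ->//|s s' t t' _ IHs _ IHt|s t|y|x x' y|x y y'|a x y].
- by rewrite !big_cat /= IHs IHt.
- by rewrite !big_cat /= addrC.
- rewrite big_seq1 big_nil /=.
  by apply: (addrI (b 0 y)); rewrite -bDl !addr0.
- by rewrite big_seq1 big_cons big_seq1 /= bDl.
- by rewrite big_seq1 big_cons big_seq1 /= bDr.
- by rewrite !big_seq1 /= bZ.
Qed.

End TensorAlgebra.

Section TensorNormFacts.
Context {R : realType} {K : numFieldType} {re : K -> R}.
Variable iota : {rmorphism R -> K}.
Hypothesis hre : real_part re iota.
Context {X Y : normedModType K}.
Implicit Types (x : X) (y : Y) (s : seq (X * Y)).

Local Notation abs z := (re `|z|).

Lemma dual_pair_balanced (f : dual X) (g : dual Y) :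
  balanced (fun x y => f x * g y : K).
Proof.
split=> [x x' y|x y y'|a x y]; rewrite ?linearD ?mulrDl ?mulrDr //.
by rewrite !linearZ /= -[a *: f x]/(a * f x) -[a *: g y]/(a * g y) mulrCA mulrA.
Qed.

Lemma injective_norm_ge s (f : dual X) (g : dual Y) :
  dual_norm re f <= 1 -> dual_norm re g <= 1 ->
  ((abs (\sum_(p <- s) f p.1 * g p.2))%:E <= injective_norm re (tens_sum s))%E.
Proof. by move=> f1 g1; apply: ereal_sup_ubound; exists s, f, g; split. Qed.

Lemma injective_norm_le s (c : R) :
  (forall (f : dual X) (g : dual Y), dual_norm re f <= 1 -> dual_norm re g <= 1 ->
    abs (\sum_(p <- s) f p.1 * g p.2) <= c) ->
  (injective_norm re (tens_sum s) <= c%:E)%E.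
Proof.
move=> sc; apply: ge_ereal_sup => _ [t [f [g [st f1 g1 ->]]]].
rewrite lee_fin -(balanced_sum_eq (dual_pair_balanced f g) st).
exact: sc.
Qed.

Lemma projective_norm_le x y :
  (projective_norm re (tens x y) <= (rnorm re x * rnorm re y)%:E)%E.
Proof.
apply: ereal_inf_lbound; exists [:: (x, y)]; first by rewrite /= tens_sum1.
by rewrite big_seq1.
Qed.

(** A bilinear form bounded by M on pairs of unit vectors is bounded by M for the
    projective norm, since every representation of a tensor gives it the same
    value. *)
Lemma projective_norm_ge (b : X -> Y -> K) (M : R) s : balanced b -> 0 < M ->
  (forall x y, abs (b x y) <= M * (rnorm re x * rnorm re y)) ->
  ((abs (\sum_(p <- s) b p.1 p.2) / M)%:E <= projective_norm re (tens_sum s))%E.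
Proof.
move=> bb M0 bM; apply: le_ereal_inf_tmp => _ [t /= st <-].
rewrite lee_fin ler_pdivrMr // mulrC (balanced_sum_eq bb st) mulr_sumr.
by apply: le_trans (abs_sum hre _ _) _; apply: ler_sum.
Qed.

Lemma dual_ball_le (Z : normedModType K) (f : dual Z) z :
  dual_norm re f <= 1 -> abs (f z) <= rnorm re z.
Proof.
move=> f1; apply: le_trans (le_dual_norm hre f z) _.
by rewrite ler_piMl ?(rnorm_ge0 hre).
Qed.

(** The lower bound pairs x and y with norming functionals. *)
Lemma injective_norm_tens x y : scalar_field re ->
  injective_norm re (tens x y) = (rnorm re x * rnorm re y)%:E.
Proof.
move=> hK; apply/le_anti/andP; rewrite -tens_sum1; split.
  apply: injective_norm_le => f g f1 g1; rewrite big_seq1 /= (absM hre).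
  by apply: ler_pM; rewrite ?(abs_ge0 hre) ?dual_ball_le.
have [f f1 <-] := norming_functional x hK.
have [g g1 <-] := norming_functional y hK.
rewrite -(absM hre).
by have := injective_norm_ge [:: (x, y)] f1 g1; rewrite big_seq1.
Qed.

(** Norming functionals of x and y form a bilinear form bounded by 1 whose value
    at (x, y) is the product of the norms. *)
Lemma projective_norm_tens x y : scalar_field re ->
  projective_norm re (tens x y) = (rnorm re x * rnorm re y)%:E.
Proof.
move=> hK; apply/le_anti/andP; split; first exact: projective_norm_le.
have [f f1 <-] := norming_functional x hK.
have [g g1 <-] := norming_functional y hK.
rewrite -(absM hre) -tens_sum1 -[abs _]divr1.
have := projective_norm_ge [:: (x, y)] (dual_pair_balanced f g) ltr01.
rewrite big_seq1; apply=> x' y'; rewrite mul1r (absM hre).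
by apply: ler_pM; rewrite ?(abs_ge0 hre) ?dual_ball_le.
Qed.

End TensorNormFacts.

(** * The von Neumann-Jordan constant *)

Section JordanVonNeumann.
Context {R : realType} {K : numFieldType} {re : K -> R}.
Variable iota : {rmorphism R -> K}.
Hypothesis hre : real_part re iota.

Lemma CNJ_parallelogram (Z : normedModType K) (c : R) : CNJ re Z = c%:E ->
  forall x y : Z, rnorm re (x + y) ^+ 2 + rnorm re (x - y) ^+ 2 <=
    2 * c * (rnorm re x ^+ 2 + rnorm re y ^+ 2).
Proof.
move=> hc x y; have [[-> ->]|xy0] := eqVneq (x, y) (0, 0).
  by rewrite addr0 subr0 (rnorm0 hre) expr0n /= addr0 mulr0.
have den : 0 < 2 * (rnorm re x ^+ 2 + rnorm re y ^+ 2).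
  rewrite mulr_gt0 // lt0r addr_ge0 ?sqr_ge0 // andbT.
  rewrite paddr_eq0 ?sqr_ge0 // !sqrf_eq0 !(rnorm_eq0 hre).
  by apply: contra xy0 => /andP[/eqP -> /eqP ->].
rewrite mulrAC -ler_pdivrMl // mulrC -lee_fin -hc.
by apply: ereal_sup_ubound; exists x, y.
Qed.

Lemma CNJ_le_scaled_embedding (X Z : normedModType K) (j : X -> Z) (k : R) :
  {morph j : x y / x + y} -> {morph j : x y / x - y} -> 0 < k ->
  (forall x, rnorm re (j x) = k * rnorm re x) -> (CNJ re X <= CNJ re Z)%E.
Proof.
move=> jD jB k0 jk; apply: ge_ereal_sup => _ [x [y [xy0 ->]]].
apply: ereal_sup_ubound; exists (j x), (j y); split.
  apply: contra xy0; rewrite !xpair_eqE -!(rnorm_eq0 hre) !jk.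
  by rewrite !mulf_eq0 gt_eqF.
congr (_%:E); rewrite -jD -jB !jk !exprMn -!mulrDr mulrCA.
by rewrite -mulf_div divff ?mul1r // expf_neq0 // gt_eqF.
Qed.

Lemma CNJ_ge1 (X : normedModType K) (x : X) : x != 0 -> (1 <= CNJ re X)%E.
Proof.
move=> x0; apply: ereal_sup_ubound; exists x, 0; split.
  by rewrite xpair_eqE negb_and x0.
rewrite addr0 subr0 (rnorm0 hre) expr0n /= addr0 -mulr2n -(mulr_natl (_ ^+ 2)) divff //.
by rewrite mulf_neq0 ?pnatr_eq0 // expf_neq0 // (rnorm_eq0 hre).
Qed.

End JordanVonNeumann.

(** * Walsh matrices and the iterated parallelogram inequality *)

(** The index set {0, 1}^m, with a recursive structure that makes the Walsh matrix
    a Kronecker power, so that statements on it follow by induction on m. *)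
Fixpoint cube (m : nat) : finType :=
  if m is k.+1 then (bool * cube k)%type else unit.

Lemma card_cube m : #|cube m| = (2 ^ m)%N.
Proof. by elim: m => [|m IH]; rewrite ?card_unit //= card_prod card_bool IH expnS. Qed.

(** The parity of the scalar product of p and q: the entry of the Walsh matrix is
    (-1) to this power. *)
Fixpoint walsh (m : nat) : cube m -> cube m -> bool :=
  if m is k.+1 return cube m -> cube m -> bool
  then fun p q => (p.1 && q.1) (+) walsh p.2 q.2 else fun _ _ => false.

Lemma sum_cubeS (W : nmodType) m (F : cube m.+1 -> W) :
  \sum_p F p = \sum_k F (true, k) + \sum_k F (false, k).
Proof.
transitivity (\sum_b \sum_k F (b, k)); last by rewrite big_bool.
by rewrite pair_bigA; apply: eq_bigr => -[b k].
Qed.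

Lemma walsh_orthogonal (A : comPzRingType) m (k l : cube m) :
  \sum_j (-1) ^+ walsh k j * (-1) ^+ walsh j l = (2 ^ m)%:R * (k == l)%:R :> A.
Proof.
elim: m k l => [|m IH] k l /=.
  rewrite (big_pred1 tt) => [|[]//]; by case: k l => -[]; rewrite expr0 mulr1.
case: k l => [a k] [b l]; rewrite sum_cubeS /=.
under eq_bigr do rewrite andbT !signr_addb mulrACA.
under [X in _ + X]eq_bigr do rewrite andbF !addFb.
rewrite -mulr_sumr !IH xpair_eqE expnS natrM.
case: a b => [] []; rewrite ?expr0 ?expr1 /=; ring.
Qed.

Lemma sum_cube_const (R : pzRingType) m (x : R) :
  \sum_(k : cube m) x = (2 ^ m)%:R * x.
Proof. by rewrite sumr_const card_cube mulr_natl. Qed.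

Lemma walsh_sym m (k l : cube m) : walsh k l = walsh l k.
Proof. by elim: m k l => [//|m IH] [a k] [b l] /=; rewrite andbC IH. Qed.

Section WalshParallelogram.
Context {R : realType} {K : numFieldType} {re : K -> R}.
Variable iota : {rmorphism R -> K}.
Hypothesis hre : real_part re iota.

(** The matrix of order 2^(m+1) sends (u_0, u_1) to (v_0 + v_1, v_0 - v_1), where
    v_b is the image of u_b under the matrix of order 2^m. One use of the
    parallelogram inequality thus costs a factor 2 c. *)
Lemma walsh_parallelogram (Z : normedModType K) (c : R) :
  (forall x y : Z, rnorm re (x + y) ^+ 2 + rnorm re (x - y) ^+ 2 <=
    2 * c * (rnorm re x ^+ 2 + rnorm re y ^+ 2)) -> 0 <= c ->
  forall m (u : cube m -> Z),
  \sum_k rnorm re (\sum_j (-1) ^+ walsh k j *: u j) ^+ 2 <=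
    (2 * c) ^+ m * \sum_j rnorm re (u j) ^+ 2.
Proof.
move=> para c0; elim=> [|m IH] u.
  rewrite !(big_pred1 tt) => [|[]//|[]//|[]//].
  by rewrite expr0 scale1r mul1r.
pose v b k := \sum_j (-1) ^+ walsh k j *: u (b, j) : Z.
have split_row a k : \sum_j (-1) ^+ walsh ((a, k) : cube m.+1) j *: u j =
    v false k + (-1) ^+ a *: v true k.
  rewrite sum_cubeS addrC /v scaler_sumr /=; congr (_ + _).
    by apply: eq_bigr => j _; rewrite andbF addFb.
  by apply: eq_bigr => j _; rewrite andbT signr_addb scalerA.
rewrite 2!sum_cubeS -big_split.
apply: (@le_trans _ _ (\sum_k 2 * c *
    (rnorm re (v false k) ^+ 2 + rnorm re (v true k) ^+ 2))).
  apply: ler_sum => k _; cbv beta; rewrite !split_row expr0 expr1 scaleN1r scale1r [leLHS]addrC.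
  exact: para.
rewrite -mulr_sumr big_split exprS -[leRHS]mulrA ler_wpM2l ?mulr_ge0 // mulrDr addrC.
by apply: lerD; exact: IH.
Qed.

End WalshParallelogram.

(** * Duality in Euclidean space *)

(** Lagrange's identity: twice the difference of both sides is the sum over (i, j)
    of (a_i b_j - a_j b_i)^2. *)
Lemma cauchy_schwarz_sum (R : realFieldType) (I : finType) (a b : I -> R) :
  (\sum_i a i * b i) ^+ 2 <= (\sum_i a i ^+ 2) * (\sum_i b i ^+ 2).
Proof.
have : 0 <= \sum_i \sum_j (a i * b j - a j * b i) ^+ 2.
  by apply: sumr_ge0 => i _; apply: sumr_ge0 => j _; exact: sqr_ge0.
have -> : \sum_i \sum_j (a i * b j - a j * b i) ^+ 2 =
    \sum_i \sum_j (a i ^+ 2 * b j ^+ 2) + \sum_i \sum_j (b i ^+ 2 * a j ^+ 2) -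
    2 * \sum_i \sum_j (a i * b i) * (a j * b j).
  rewrite mulr_sumr -big_split -sumrB /=; apply: eq_bigr => i _.
  rewrite mulr_sumr -big_split -sumrB /=; apply: eq_bigr => j _; ring.
rewrite -!big_distrlr /= -expr2 [X in _ + X - _]mulrC.
lra.
Qed.

Section Ell2Duality.
Context {R : realType} {K : numFieldType} {re : K -> R}.
Variable iota : {rmorphism R -> K}.
Hypothesis hre : real_part re iota.

Local Notation abs z := (re `|z|).

(** Euclidean space is its own dual: test the functional a against the vector with
    c_i a_i = |a_i|^2, which has the same Euclidean norm as a. Defining c_i by a
    division dispenses with complex conjugation. *)
Lemma ell2_dual_le (I : finType) (a : I -> K) (M : R) : 0 <= M ->
  (forall c : I -> K,
    abs (\sum_i c i * a i) <= M * Num.sqrt (\sum_i abs (c i) ^+ 2)) ->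
  \sum_i abs (a i) ^+ 2 <= M ^+ 2.
Proof.
move=> M0 aM; pose S := \sum_i abs (a i) ^+ 2.
have S0 : 0 <= S by apply: sumr_ge0 => i _; exact: sqr_ge0.
pose c i := iota (abs (a i) ^+ 2) / a i.
have ca i : c i * a i = iota (abs (a i) ^+ 2).
  have [ai|ai] := eqVneq (a i) 0; last by rewrite /c divfK.
  by rewrite /c ai mulr0 (abs0 hre) expr0n rmorph0.
have absc i : abs (c i) = abs (a i).
  have [ai|ai] := eqVneq (a i) 0; first by rewrite /c ai invr0 mulr0.
  apply: (@mulIf _ (abs (a i))); first by rewrite (abs_eq0 hre).
  by rewrite -(absM hre) ca (abs_iota hre) ?sqr_ge0 // expr2.
have := aM c; under eq_bigr do rewrite ca.
rewrite -rmorph_sum /= (abs_iota hre) // -/S.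
under eq_bigr do rewrite absc.
rewrite -/S -{1}(sqr_sqrtr S0) => SM.
have [S00|Sn0] := eqVneq S 0; first by rewrite S00 sqr_ge0.
have sS : 0 < Num.sqrt S by rewrite sqrtr_gt0 lt0r Sn0.
rewrite -(sqr_sqrtr S0) ler_pXn2r ?nnegrE ?sqrtr_ge0 //.
by rewrite -(ler_pM2r sS) -expr2.
Qed.

Lemma abs_sign_sum_le (I : finType) (sg : I -> bool) (a b : I -> K) (A B : R) :
  0 <= A -> 0 <= B -> \sum_i abs (a i) ^+ 2 <= A ^+ 2 ->
  \sum_i abs (b i) ^+ 2 <= B ^+ 2 ->
  abs (\sum_i (-1) ^+ sg i * (a i * b i)) <= A * B.
Proof.
move=> A0 B0 aA bB; apply: (@le_trans _ _ (\sum_i abs (a i) * abs (b i))).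
  apply: le_trans (abs_sum hre _ _) _; apply: ler_sum => i _.
  by rewrite !(absM hre) (abs_sign hre) mul1r.
rewrite -(@ler_pXn2r _ 2) ?nnegrE ?mulr_ge0 //; last first.
  by apply: sumr_ge0 => i _; rewrite mulr_ge0 ?(abs_ge0 hre).
apply: le_trans (cauchy_schwarz_sum _ _) _; rewrite exprMn.
by apply: ler_pM => //; apply: sumr_ge0 => i _; exact: sqr_ge0.
Qed.

End Ell2Duality.

(** * Almost Euclidean systems of vectors *)

Section Ell2Frames.
Context {R : realType} {K : numFieldType} {re : K -> R}.
Variable iota : {rmorphism R -> K}.
Hypothesis hre : real_part re iota.

Local Notation abs z := (re `|z|).

(** A one-sided form of closeness to the unit vector basis of ell_2: the lower
    estimate is asked for single vectors only. With t = |T| and s = |T^-1|, every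
    isomorphism T onto ell_2^d provides such a system, and t s is the quantity
    minimized by the Banach-Mazur distance. *)
Definition ell2_frame (I : finType) (V : lmodType K) (nV : V -> R)
    (e : I -> V) (s t : R) : Prop :=
  [/\ 0 < s, 0 < t,
      forall c : I -> K,
        nV (\sum_i c i *: e i) <= s * Num.sqrt (\sum_i abs (c i) ^+ 2)
    & forall i, 1 <= t * nV (e i)].

Section Frames.
Context {V : lmodType K} (nV : V -> R).
Hypothesis nV_ge0 : forall x, 0 <= nV x.
Hypothesis nVZ : forall a x, nV (a *: x) = abs a * nV x.
Hypothesis nV_eq0 : forall x, nV x = 0 -> x = 0.

Let n2 d := @euclidean_norm R K re d.

Let nV0 : nV 0 = 0.
Proof. by rewrite -(scale0r 0) nVZ (abs0 hre) mul0r. Qed.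

Lemma euclidean_normZ d a (u : 'rV[K]_d) : n2 (a *: u) = abs a * n2 u.
Proof.
rewrite /n2 /euclidean_norm; under eq_bigr do rewrite mxE (absM hre) exprMn.
by rewrite -mulr_sumr sqrtrM ?sqr_ge0 // sqrtr_sqr ger0_norm // (abs_ge0 hre).
Qed.

Lemma euclidean_norm_eq0 d (u : 'rV[K]_d) : n2 u = 0 -> u = 0.
Proof.
move/eqP; rewrite sqrtr_eq0 => u0; apply/rowP => i; rewrite mxE.
have {}u0 : \sum_(i < d) abs (u ord0 i) ^+ 2 = 0.
  by apply/le_anti; rewrite u0 sumr_ge0 // => j _; exact: sqr_ge0.
move/eqP: u0; rewrite psumr_eq0 => [/allP/(_ i)|j _]; last exact: sqr_ge0.
by rewrite mem_index_enum sqrf_eq0 (abs_eq0 hre) => /(_ isT)/eqP.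
Qed.

Lemma euclidean_norm_delta d (i : 'I_d) : n2 (delta_mx ord0 i) = 1.
Proof.
rewrite /n2 /euclidean_norm (bigD1 i) //= big1 => [|j /negPf ji].
  by rewrite mxE !eqxx addr0 (abs_sign hre 0) expr1n sqrtr1.
by rewrite mxE ji andbF (abs0 hre) expr0n.
Qed.

(** The system is the image of the unit vector basis under S. Both operator norms
    are positive, so that a finite product forces each of them to be finite. *)
Lemma banach_mazur_frame d (E : set V) (T : V -> 'rV[K]_d) (S : 'rV[K]_d -> V) :
  (0 < d)%N -> has_dim d E -> linear_iso E setT T S ->
  (opnorm nV (n2 (d := d)) E T * opnorm (n2 (d := d)) nV setT S < +oo)%E ->
  exists (e : 'I_d -> V) (s t : R), ell2_frame nV e s t /\
    (opnorm nV (n2 (d := d)) E T * opnorm (n2 (d := d)) nV setT S)%E = (t * s)%:E.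
Proof.
move=> d0 [b [_ EE]] [Tlin TK SK].
have E0 : E 0 by rewrite EE; exists (fun=> 0) => //; apply: big1 => i _; rewrite scale0r.
have Elin a x y : E x -> E y -> E (a *: x + y).
  rewrite EE => -[c _ <-] [c' _ <-]; exists (fun i => a * c i + c' i) => //.
  rewrite scaler_sumr -big_split /=; apply: eq_bigr => i _.
  by rewrite scalerDl scalerA.
have T0 : T 0 = 0.
  by have /eqP := Tlin 1 _ _ E0 E0; rewrite !scale1r addr0 -subr_eq subrr eq_sym => /eqP.
pose e i := S (delta_mx ord0 i).
have Ee i : E (e i) by have [] := SK (delta_mx ord0 i) I.
have Te i : T (e i) = delta_mx ord0 i by have [] := SK (delta_mx ord0 i) I.
have sumE (c : 'I_d -> K) (r : seq 'I_d) : E (\sum_(i <- r) c i *: e i) /\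
    T (\sum_(i <- r) c i *: e i) = \sum_(i <- r) c i *: delta_mx ord0 i.
  elim: r => [|i r [IHE IHT]]; first by rewrite !big_nil.
  by rewrite !big_cons Tlin // IHT Te; split => //; exact: Elin.
have SE u : S u = \sum_i u ord0 i *: e i.
  have [sE sT] := sumE (u ord0) (index_enum 'I_d).
  by rewrite -[RHS](TK _ sE).2 sT -row_sum_delta.
have eT i : nV (e i) != 0.
  apply/eqP => /nV_eq0 ei0; have := Te i; rewrite ei0 T0 => d0'.
  have := euclidean_norm_delta i; rewrite -d0' -(scale0r 0) euclidean_normZ.
  by rewrite (abs0 hre) mul0r => /eqP; rewrite eq_sym oner_eq0.
have e_gt0 i : 0 < nV (e i) by rewrite lt0r eT nV_ge0.
set oT := opnorm _ _ _ T; set oS := opnorm _ _ _ S.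
have leS u : n2 u <= 1 -> ((nV (S u))%:E <= oS)%E.
  by move=> u1; apply: ereal_sup_ubound; exists u.
have leT i : ((nV (e i))^-1%:E <= oT)%E.
  apply: ereal_sup_ubound; exists (iota (nV (e i))^-1 *: e i).
    split; first by have := Elin (iota (nV (e i))^-1) _ _ (Ee i) E0; rewrite addr0.
    by rewrite nVZ (abs_iota hre) ?invr_ge0 // mulVf.
  have := Tlin (iota (nV (e i))^-1) _ _ (Ee i) E0; rewrite !addr0 T0 addr0 => ->.
  rewrite Te -/(n2 _) euclidean_normZ (abs_iota hre) ?invr_ge0 //.
  by rewrite euclidean_norm_delta mulr1.
pose i0 := Ordinal d0.
have oT0 : (0 < oT)%E by apply: lt_le_trans (leT i0); rewrite lte_fin invr_gt0.
have oS0 : (0 < oS)%E.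
  apply: lt_le_trans (leS (delta_mx ord0 i0) _); first by rewrite lte_fin (e_gt0 i0).
  by rewrite euclidean_norm_delta.
case: oT oT0 leT => [t||] // t0 leT; case: oS oS0 leS => [s||] // s0 leS.
- move=> _; exists e, s, t; split=> //; split=> //.
  + move=> c; pose u : 'rV[K]_d := \row_i c i.
    have -> : \sum_i c i *: e i = S u.
      by rewrite SE; apply: eq_bigr => i _; rewrite mxE.
    have -> : Num.sqrt (\sum_i abs (c i) ^+ 2) = n2 u.
      by congr Num.sqrt; apply: eq_bigr => i _; rewrite mxE.
    have [u0|u0] := eqVneq (n2 u) 0.
      rewrite u0 mulr0 (euclidean_norm_eq0 u0) SE big1 ?nV0 // => i _.
      by rewrite mxE scale0r.
    have u_gt0 : 0 < n2 u by rewrite lt0r u0 sqrtr_ge0.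
    rewrite -ler_pdivrMr // mulrC.
    have := leS (iota (n2 u)^-1 *: u).
    rewrite euclidean_normZ (abs_iota hre) ?invr_ge0 ?(ltW u_gt0) // mulVf //.
    move=> /(_ (lexx _)); rewrite lee_fin.
    suff -> : S (iota (n2 u)^-1 *: u) = iota (n2 u)^-1 *: S u.
      by rewrite nVZ (abs_iota hre) // invr_ge0 ltW.
    rewrite !SE scaler_sumr; apply: eq_bigr => i _.
    by rewrite mxE scalerA.
  + by move=> i; rewrite -ler_pdivrMr // mul1r -lee_fin leT.
- by rewrite gt0_muley.
- by rewrite gt0_mulye.
Qed.

Lemma le_eta_norm d (k : R) : (0 < d)%N ->
  (forall (e : 'I_d -> V) (s t : R), ell2_frame nV e s t -> k <= t * s) ->
  (k%:E <= eta_norm re nV d)%E.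
Proof.
move=> d0 hk; apply: le_ereal_inf_tmp => _ [E /= dE <-].
apply: le_ereal_inf_tmp => _ [T [S [iTS ->]]].
have [fin|] := ltP (opnorm nV (n2 (d := d)) E T * opnorm (n2 (d := d)) nV setT S)%E +oo%E.
  by have [e [s [t [fr ->]]]] := banach_mazur_frame d0 dE iTS fin; rewrite lee_fin; exact: hk fr.
by apply: le_trans; rewrite leey.
Qed.

End Frames.

End Ell2Frames.
Arguments ell2_frame {R K} re {I V} nV e s t.

Section CubeFrames.
Context {R : realType} {K : numFieldType} {re : K -> R}.
Variable iota : {rmorphism R -> K}.
Hypothesis hre : real_part re iota.

Local Notation abs z := (re `|z|).

(** The Euclidean norm does not depend on how the coordinates are indexed; this
    moves systems from ordinals to the cube. *)
Lemma ell2_frame_bij (I J : finType) (phi : J -> I) (V : lmodType K)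
    (nV : V -> R) (e : I -> V) (s t : R) : bijective phi ->
  ell2_frame re nV e s t -> ell2_frame re nV (e \o phi) s t.
Proof.
move=> bphi [s0 t0 es et]; split=> // [c|j]; last exact: et.
have [psi phiK psiK] := bphi.
have := es (c \o psi).
rewrite (reindex phi) /=; last exact: onW_bij bphi.
rewrite [X in Num.sqrt X](reindex phi) /=; last exact: onW_bij bphi.
by under eq_bigr do rewrite phiK; under [X in Num.sqrt X]eq_bigr do rewrite phiK.
Qed.

Lemma le_eta_norm_cube (V : lmodType K) (nV : V -> R) m (k : R) :
  (forall x, 0 <= nV x) -> (forall a x, nV (a *: x) = abs a * nV x) ->
  (forall x, nV x = 0 -> x = 0) ->
  (forall (e : cube m -> V) (s t : R), ell2_frame re nV e s t -> k <= t * s) ->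
  (k%:E <= eta_norm re nV (2 ^ m))%E.
Proof.
move=> nV_ge0 nVZ nV_eq0 hk; apply: (le_eta_norm hre) => //.
  by rewrite expn_gt0.
move=> e s t /ell2_frame_bij fr.
have cI : #|cube m| = #|'I_(2 ^ m)| by rewrite card_cube card_ord.
pose phi (j : cube m) := enum_val (cast_ord cI (enum_rank j)).
apply: (hk (e \o phi)); apply: fr.
exists (fun i => enum_val (cast_ord (esym cI) (enum_rank i))) => j.
  by rewrite /phi enum_valK cast_ordK enum_rankK.
by rewrite /phi enum_valK cast_ordKV enum_rankK.
Qed.

End CubeFrames.

(** * Euclidean systems in the factors bound the constant of the tensor product *)

(** Were b < a, Bernoulli's inequality would contradict the hypothesis at
    theta = 1 - (a - b) / (8 a). *)
Lemma le_of_expr4_lt1 (R : realFieldType) (a b : R) : 0 < a ->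
  (forall theta, 0 <= theta -> theta < 1 -> a * theta ^+ 4 <= b) -> a <= b.
Proof.
move=> a0 ab; rewrite leNgt; apply/negP => ba.
have b0 : 0 <= b by have := ab 0 (lexx _) ltr01; rewrite expr0n mulr0.
pose delta := (a - b) / (8 * a).
have da : a * delta = (a - b) / 8 by rewrite /delta; field; rewrite gt_eqF.
have d0 : 0 < delta by rewrite divr_gt0 ?mulr_gt0 // subr_gt0.
have d1 : delta <= 1 / 8 by rewrite ler_pdivrMr ?mulr_gt0 //; lra.
have := ab (1 - delta); rewrite subr_ge0 gtrBl => /(_ _ d0).
have bern : 1 - 4 * delta <= (1 - delta) ^+ 4.
  have -> : (1 - delta) ^+ 4 = 1 - 4 * delta +
    delta ^+ 2 * (2 + (2 - delta) ^+ 2) by ring.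
  by rewrite lerDl mulr_ge0 ?sqr_ge0 // addr_ge0 ?sqr_ge0.
have := ler_wpM2l (ltW a0) bern.
lra.
Qed.

Section Bounds.
Context {R : realType} {K : numFieldType} {re : K -> R}.
Variable iota : {rmorphism R -> K}.
Hypothesis hre : real_part re iota.

Local Notation abs z := (re `|z|).

Context {X Y : normedModType K} {Z : normedModType K} {i : {linear tensor X Y -> Z}}.
Context {c : R} {m : nat}.
Hypothesis para : forall x y : Z,
  rnorm re (x + y) ^+ 2 + rnorm re (x - y) ^+ 2 <=
    2 * c * (rnorm re x ^+ 2 + rnorm re y ^+ 2).
Hypothesis c0 : 0 <= c.

Let walsh_tens (e : cube m -> X) (e' : cube m -> Y) k : tensor X Y :=
  \sum_j (-1) ^+ walsh k j *: tens (e j) (e' j).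

Let walsh_seq (e : cube m -> X) (e' : cube m -> Y) k : seq (X * Y) :=
  [seq ((-1) ^+ walsh k j *: e j, e' j) | j <- index_enum (cube m)].

Let walsh_tensE e e' k : walsh_tens e e' k = tens_sum (walsh_seq e e' k).
Proof.
rewrite /tens_sum /walsh_seq big_map; apply: eq_bigr => j _.
by rewrite tensZl.
Qed.

(** The diagonal of a tensor product of two Euclidean spaces with the injective
    norm is a space of sup-norm type, in which the rows of the Walsh matrix have
    norm 1 and their Walsh transforms have norm N: the parallelogram inequality is
    as far as possible from holding with constant 1. The two systems reproduce
    this up to the factors s s' and t t'. *)
Lemma injective_frame_bound (e : cube m -> X) (e' : cube m -> Y) (s t s' t' : R) :
  scalar_field re ->
  (forall w, (rnorm re (i w))%:E = injective_norm re w) ->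
  ell2_frame re (@rnorm R K re X) e s t ->
  ell2_frame re (@rnorm R K re Y) e' s' t' ->
  2 ^+ m <= c ^+ m * ((t * s) * (t' * s')) ^+ 2.
Proof.
move=> hK iso [s0 t0 es et] [s'0 t'0 e's e't].
have dual_frame (V : normedModType K) (v : cube m -> V) (f : dual V) r : 0 < r ->
    (forall a, rnorm re (\sum_j a j *: v j) <=
       r * Num.sqrt (\sum_j abs (a j) ^+ 2)) -> dual_norm re f <= 1 ->
    \sum_j abs (f (v j)) ^+ 2 <= r ^+ 2.
  move=> r0 vr f1; apply: (ell2_dual_le hre); first exact: ltW.
  move=> a; apply: le_trans (vr a); apply: le_trans (dual_ball_le hre _ f1).
  rewrite linear_sum /= le_eqVlt; apply/orP; left; apply/eqP.
  by congr (re `|_|); apply: eq_bigr => j _; rewrite linearZ.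
have w_le k : rnorm re (i (walsh_tens e e' k)) <= s * s'.
  rewrite -lee_fin iso walsh_tensE; apply: injective_norm_le => f g f1 g1.
  rewrite big_map /=; under eq_bigr do rewrite linearZ /= -[_ *: _]/(_ * _) -mulrA.
  apply: (abs_sign_sum_le hre); [exact: ltW|exact: ltW| |].
    exact: dual_frame s0 es f1.
  exact: dual_frame s'0 e's g1.
have diag l : \sum_k (-1) ^+ walsh l k *: i (walsh_tens e e' k) =
    (2 ^ m)%:R *: i (tens (e l) (e' l)).
  under eq_bigr do rewrite -linearZ /= /walsh_tens scaler_sumr.
  rewrite -linear_sum exchange_big /= -linearZ /=; congr (i _).
  under eq_bigr do (under eq_bigr do rewrite scalerA; rewrite -scaler_suml walsh_orthogonal).
  rewrite (bigD1 l) //= big1 => [|j /negPf jl]; last by rewrite eq_sym jl mulr0 scale0r.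
  by rewrite eqxx mulr1 addr0.
have tens_norm l : rnorm re (i (tens (e l) (e' l))) = rnorm re (e l) * rnorm re (e' l).
  by have := iso (tens (e l) (e' l)); rewrite (injective_norm_tens hre) // => -[].
have absN : abs ((2 ^ m)%:R : K) = (2 ^ m)%:R.
  by rewrite -(rmorph_nat iota) (abs_iota hre).
have := walsh_parallelogram para c0 (fun k => i (walsh_tens e e' k)).
under eq_bigr do rewrite diag (rnormZ hre) absN tens_norm.
set N : R := (2 ^ m)%:R; move=> main.
have lower : N * (N / (t * t')) ^+ 2 <=
    \sum_l (N * (rnorm re (e l) * rnorm re (e' l))) ^+ 2.
  rewrite -sum_cube_const; apply: ler_sum => l _.
  rewrite ler_pXn2r ?nnegrE ?divr_ge0 ?mulr_ge0 ?(rnorm_ge0 hre) ?(ltW t0) ?(ltW t'0) //.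
  rewrite ler_wpM2l // invfM.
  by apply: ler_pM; rewrite ?invr_ge0 ?(ltW t0) ?(ltW t'0) // -[leLHS]mul1r
    ler_pdivrMr // mulrC.
have upper : \sum_j rnorm re (i (walsh_tens e e' j)) ^+ 2 <= N * (s * s') ^+ 2.
  rewrite -sum_cube_const; apply: ler_sum => l _.
  by rewrite ler_pXn2r ?nnegrE ?(rnorm_ge0 hre) ?mulr_ge0 ?(ltW s0) ?(ltW s'0).
have {lower upper main} : N * (N / (t * t')) ^+ 2 <= N * c ^+ m * (N * (s * s') ^+ 2).
  rewrite /N natrX -exprMn -natrX; apply: le_trans lower (le_trans main _).
  by rewrite ler_wpM2l // exprn_ge0 // mulr_ge0.
have N0 : 0 < N by rewrite ltr0n expn_gt0.
rewrite expr_div_n [N * (_ / _)]mulrA ler_pdivrMr ?exprn_gt0 ?mulr_gt0 // => main.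
rewrite -(ler_pM2l (exprn_gt0 2 N0)) -natrX -/N.
by apply: le_trans (le_trans main _); rewrite le_eqVlt; apply/orP; left; apply/eqP; ring.
Qed.

(** The dual counterpart: the bilinear forms b_k on X x Y play the part of the
    diagonal tensors, and are tested against the Walsh transform of the elementary
    tensors x_j (x) y_j. *)
Lemma projective_frame_bound (f : cube m -> dual X) (g : cube m -> dual Y)
    (s t s' t' : R) :
  (forall w, (rnorm re (i w))%:E = projective_norm re w) ->
  ell2_frame re (@dual_norm R K re X) f s t ->
  ell2_frame re (@dual_norm R K re Y) g s' t' ->
  2 ^+ m <= c ^+ m * ((t * s) * (t' * s')) ^+ 2.
Proof.
move=> iso [s0 t0 fs ft] [s'0 t'0 gs gt].
have frame_pt (V : normedModType K) (h : cube m -> dual V) r (x : V) : 0 < r ->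
    (forall a, dual_norm re (\sum_j a j *: h j) <=
       r * Num.sqrt (\sum_j abs (a j) ^+ 2)) ->
    \sum_j abs (h j x) ^+ 2 <= (r * rnorm re x) ^+ 2.
  move=> r0 hr; apply: (ell2_dual_le hre) => [|a].
    by rewrite mulr_ge0 ?(rnorm_ge0 hre) // ltW.
  have := le_dual_norm hre (\sum_j a j *: h j) x.
  rewrite dual_fun_sum => /le_trans; apply.
  by rewrite mulrAC ler_wpM2r ?(rnorm_ge0 hre).
pose b k (x : X) (y : Y) : K := \sum_l (-1) ^+ walsh k l * (f l x * g l y).
have bal k : balanced (b k).
  split=> [x x' y|x y y'|a x y]; rewrite /b -?big_split /=; apply: eq_bigr => l _;
    have [Dl Dr ZZ] := dual_pair_balanced (f l) (g l).
  - by rewrite Dl mulrDr.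
  - by rewrite Dr mulrDr.
  - by rewrite ZZ.
have bZ k a x y : b k (a *: x) y = a * b k x y.
  rewrite /b mulr_sumr; apply: eq_bigr => l _.
  by rewrite linearZ /= -[_ *: _]/(_ * _) -mulrA mulrCA.
have b_le k x y : abs (b k x y) <= s * s' * (rnorm re x * rnorm re y).
  rewrite mulrACA; apply: (abs_sign_sum_le hre).
  - by rewrite mulr_ge0 ?(rnorm_ge0 hre) // ltW.
  - by rewrite mulr_ge0 ?(rnorm_ge0 hre) // ltW.
  - exact: frame_pt fs.
  - exact: frame_pt gs.
set N : R := (2 ^ m)%:R; have N0 : 0 < N by rewrite ltr0n expn_gt0.
have ss0 : 0 < s * s' by rewrite mulr_gt0.
(* the dual norms need not be attained: theta is the loss in each factor *)
have attain theta : 0 <= theta -> theta < 1 ->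
    N * theta ^+ 4 <= c ^+ m * ((t * s) * (t' * s')) ^+ 2.
  move=> th0 th1.
  have below (V : normedModType K) (h : cube m -> dual V) r : 0 < r ->
      (forall j, 1 <= r * dual_norm re (h j)) -> forall j, exists x : V,
      rnorm re x <= 1 /\ h j x = iota (theta / r).
    move=> r0 hr j.
    have [||x x1 hx] := @dual_norm_attained_below _ _ _ _ hre _ (h j) (theta / r).
    - by rewrite divr_ge0 // ltW.
    - rewrite ltr_pdivrMr // mulrC; exact: lt_le_trans (hr j).
    by exists x.
  have [x xP] := choice (below _ f t t0 ft).
  have [y yP] := choice (below _ g t' t'0 gt).
  (* the sum is the value of b_k at the k-th Walsh combination of the x_j (x) y_j *)
  have form_le k : abs (\sum_j (-1) ^+ walsh k j * b k (x j) (y j)) <=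
      s * s' * rnorm re (i (walsh_tens x y k)).
    rewrite mulrC -ler_pdivrMr // -lee_fin iso walsh_tensE.
    have := projective_norm_ge hre (walsh_seq x y k) (bal k) ss0 (b_le k).
    by rewrite big_map /=; under eq_bigr do rewrite bZ.
  (* orthogonality of the Walsh matrix leaves only the terms f_j x_j * g_j y_j *)
  have total : \sum_k \sum_j (-1) ^+ walsh k j * b k (x j) (y j) =
      iota (N * (N * (theta / t * (theta / t')))).
    rewrite exchange_big /= -sum_cube_const rmorph_sum /=; apply: eq_bigr => j _.
    under eq_bigr do rewrite /b mulr_sumr.
    rewrite exchange_big /=.
    under eq_bigr do (under eq_bigr do rewrite (walsh_sym _ j) mulrA;
      rewrite -mulr_suml walsh_orthogonal).
    rewrite (bigD1 j) //= big1 => [|l /negPf lj]; last by rewrite eq_sym lj mulr0 mul0r.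
    by rewrite eqxx mulr1 addr0 (xP j).2 (yP j).2 !rmorphM /= rmorph_nat.
  pose r k := rnorm re (i (walsh_tens x y k)).
  have r_ge0 k : 0 <= r k by exact: (rnorm_ge0 hre).
  have lower : N * (N * (theta / t * (theta / t'))) <= s * s' * \sum_k r k.
    rewrite -(abs_iota hre (_ : 0 <= N * _)) -?total.
      apply: le_trans (abs_sum hre _ _) _; rewrite mulr_sumr.
      by apply: ler_sum => k _; exact: form_le.
    by rewrite !mulr_ge0 ?invr_ge0 // ltW.
  have upper : (\sum_k r k) ^+ 2 <= N * ((2 * c) ^+ m * N).
    have := cauchy_schwarz_sum (fun=> 1) r.
    under eq_bigr do rewrite mul1r.
    under [X in _ <= X * _]eq_bigr do rewrite expr1n.
    rewrite sum_cube_const mulr1 -/N => /le_trans; apply.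
    rewrite ler_wpM2l // ?(ltW N0) //.
    have := walsh_parallelogram para c0 (fun j => i (tens (x j) (y j))).
    under eq_bigr do (under eq_bigr do rewrite -linearZ /=; rewrite -linear_sum).
    move=> /le_trans; apply; rewrite ler_wpM2l ?exprn_ge0 ?mulr_ge0 //.
    rewrite -[leRHS]mulr1 -sum_cube_const; apply: ler_sum => j _.
    rewrite exprn_ile1 ?(rnorm_ge0 hre) // -lee_fin iso.
    apply: le_trans (projective_norm_le _ _) _; rewrite lee_fin.
    by rewrite mulr_ile1 ?(rnorm_ge0 hre) // ?(xP j).1 ?(yP j).1.
  have {}lower : (N * N) * theta ^+ 2 <= (t * s) * (t' * s') * \sum_k r k.
    have tt0 : 0 < t * t' by rewrite mulr_gt0.
    rewrite -(ler_pM2l tt0) in lower; apply: le_trans (le_trans _ lower) _.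
      rewrite le_eqVlt; apply/orP; left; apply/eqP; field.
      by rewrite !gt_eqF.
    by rewrite le_eqVlt; apply/orP; left; apply/eqP; ring.
  have N3 : 0 < N ^+ 3 by rewrite exprn_gt0.
  rewrite -(ler_pM2l N3).
  have -> : N ^+ 3 * (N * theta ^+ 4) = (N * N * theta ^+ 2) ^+ 2 by ring.
  apply: (@le_trans _ _ ((t * s * (t' * s') * \sum_k r k) ^+ 2)).
    have rr0 : 0 <= \sum_k r k by exact: sumr_ge0.
    by rewrite ler_pXn2r // nnegrE !mulr_ge0 ?sqr_ge0 // ltW.
  rewrite exprMn; apply: le_trans (ler_wpM2l (sqr_ge0 _) upper) _.
  rewrite [(2 * c) ^+ m]exprMn -natrX -/N.
  by rewrite le_eqVlt; apply/orP; left; apply/eqP; ring.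
by rewrite -natrX; exact: le_of_expr4_lt1 attain.
Qed.

End Bounds.

(** * Lower bounds for the von Neumann-Jordan constant of tensor products *)

(** The hypotheses on a and b say that they dominate the infima of D1 and D2, the
    infimum of the empty set being infinite; in particular D2 is not empty, which
    settles the case a <= 0. *)
Lemma le_mul_of_inf (R : realFieldType) (D1 D2 : set R) (a b k : R) : 0 < k ->
  (forall r, D2 r -> 0 < r) -> (forall r r', D1 r -> D2 r' -> k <= r * r') ->
  (forall q, (forall r, D1 r -> q <= r) -> q <= a) ->
  (forall q, (forall r, D2 r -> q <= r) -> q <= b) -> k <= a * b.
Proof.
move=> k0 D2p kD ha hb.
have ka r' : D2 r' -> k <= a * r'.
  move=> D2r; have r'0 := D2p _ D2r; rewrite -ler_pdivrMr //; apply: ha => r D1r.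
  by rewrite ler_pdivrMr // kD.
have [a0|a0] := ltP 0 a.
  by rewrite mulrC -ler_pdivrMr //; apply: hb => r /ka; rewrite ler_pdivrMr // mulrC.
suff : b + 1 <= b by rewrite gerDl ler10.
apply: hb => r D2r; have := ka _ D2r; have := D2p _ D2r; nra.
Qed.

(** The bound on the product of the indices is (2 / c)^(m/2), the value at which the
    last term equals c; negative powers reverse the order. *)
Lemma eta_term_le (R : realType) m (a b : \bar R) (c : R) : (1 <= m)%N -> 0 < c ->
  (0 <= a)%E -> (0 <= b)%E ->
  (a != +oo%E -> b != +oo%E ->
    (2 / c) `^ (m%:R / 2) <= fine a * fine b) ->
  (eta_term m a b <= c%:E)%E.
Proof.
move=> m1 c0 a0 b0 ab; rewrite /eta_term.
case: ifPn => [_|]; first by rewrite lee_fin ltW.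
rewrite negb_or => /andP[aoo boo]; rewrite lee_fin.
have m0 : m%:R != 0 :> R by rewrite pnatr_eq0 -lt0n.
have tc : 0 < 2 / c by rewrite divr_gt0.
have kp : 0 < (2 / c) `^ (m%:R / 2) by rewrite powR_gt0.
have ck : ((2 / c) `^ (m%:R / 2)) `^ (2 / m%:R) = 2 / c.
  by rewrite -powRrM mulrA divfK ?pnatr_eq0 // divff // powRr1 // ltW.
have abp := lt_le_trans kp (ab aoo boo).
rewrite powRN -ler_pdivlMl // -[leRHS]invrK lef_pV2 ?posrE ?powR_gt0 ?invr_gt0 //;
  last by rewrite mulr_gt0 // invr_gt0.
rewrite invfM invrK -ck ge0_ler_powR ?nnegrE ?divr_ge0 ?(ltW kp) ?(ltW abp) //.
exact: ab.
Qed.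

Lemma eta_term1E (R : realType) (a b : \bar R) : (0 <= a)%E -> (0 <= b)%E ->
  a != +oo%E -> b != +oo%E ->
  eta_term 1 a b = (2 / (fine a ^+ 2 * fine b ^+ 2))%:E.
Proof.
move=> a0 b0 aoo boo; rewrite /eta_term (negPf aoo) (negPf boo) /= divr1 powRN.
by rewrite powR_mulrn ?exprMn // mulr_ge0 ?fine_ge0.
Qed.

Lemma powR_half_le (R : realType) m (c q : R) : 0 < c -> 0 <= q ->
  2 ^+ m <= c ^+ m * q ^+ 2 -> (2 / c) `^ (m%:R / 2) <= q.
Proof.
move=> c0 q0 mq; rewrite -(@ler_pXn2r _ 2) ?nnegrE ?powR_ge0 //.
rewrite -powR_mulrn ?powR_ge0 // -powRrM divfK // powR_mulrn ?divr_ge0 ?(ltW c0) //.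
by rewrite expr_div_n ler_pdivrMr ?exprn_gt0 // mulrC.
Qed.

Section Main.
Context {R : realType} {K : numFieldType} {re : K -> R}.
Variable iota : {rmorphism R -> K}.
Hypothesis hre : real_part re iota.

Local Notation abs z := (re `|z|).

(** The properties common to the norm of a space and to the dual norm that make
    the index eta_N meaningful. *)
Definition abs_norm (V : lmodType K) (nV : V -> R) : Prop :=
  [/\ forall x, 0 <= nV x, forall a x, nV (a *: x) = abs a * nV x
    & forall x, nV x = 0 -> x = 0].

Lemma rnorm_abs_norm (X : normedModType K) : abs_norm (@rnorm R K re X).
Proof.
split=> [x|a x|x /eqP]; [exact: (rnorm_ge0 hre)|exact: (rnormZ hre)|].
by rewrite (rnorm_eq0 hre) => /eqP.
Qed.

Lemma dual_norm_abs_norm (X : normedModType K) : abs_norm (@dual_norm R K re X).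
Proof.
by split=> *; [exact: (dual_norm_ge0 hre)|exact: (dual_normZ hre)|
  exact: (dual_norm_eq0 hre)].
Qed.

Lemma eta_norm_ge0 (V : lmodType K) (nV : V -> R) m : abs_norm nV ->
  (0 <= eta_norm re nV (2 ^ m))%E.
Proof.
case=> nV0 nVZ nVe; apply: (le_eta_norm_cube hre) => // e s t [s0 t0 _ _].
by rewrite mulr_ge0 // ltW.
Qed.

Lemma eta_norm_mul_ge (V W : lmodType K) (nV : V -> R) (nW : W -> R) m (k : R) :
  abs_norm nV -> abs_norm nW -> 0 < k ->
  (forall (e : cube m -> V) (e' : cube m -> W) (s t s' t' : R),
    ell2_frame re nV e s t -> ell2_frame re nW e' s' t' ->
    k <= (t * s) * (t' * s')) ->
  eta_norm re nV (2 ^ m) != +oo%E -> eta_norm re nW (2 ^ m) != +oo%E ->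
  k <= fine (eta_norm re nV (2 ^ m)) * fine (eta_norm re nW (2 ^ m)).
Proof.
move=> nVn nWn k0 hk a_fin b_fin.
pose D (U : lmodType K) (nU : U -> R) := [set r : R | exists (e : cube m -> U) s t,
  ell2_frame re nU e s t /\ r = t * s].
have inf_le (U : lmodType K) (nU : U -> R) : abs_norm nU ->
    eta_norm re nU (2 ^ m) != +oo%E ->
    forall q, (forall r, D U nU r -> q <= r) -> q <= fine (eta_norm re nU (2 ^ m)).
  move=> nUn fin q Dq; have [n0 nZ ne] := nUn.
  rewrite -lee_fin fineK; last by rewrite ge0_fin_numE ?eta_norm_ge0 // ltey.
  apply: (le_eta_norm_cube hre) => // e s t fr.
  by apply: Dq; exists e, s, t.
apply: (@le_mul_of_inf _ (D V nV) (D W nW)) => //; try exact: inf_le.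
  by move=> _ [e [s [t [[s0 t0 _ _] ->]]]]; rewrite mulr_gt0.
move=> _ _ [e [s [t [fr ->]]]] [e' [s' [t' [fr' ->]]]].
exact: hk fr fr'.
Qed.

(** The argument common to both tensor norms. If the constant of Z is infinite
    there is nothing to prove; otherwise it is a real c >= 1 for which the
    parallelogram inequality holds, and the hypothesis on systems applies. *)
Lemma CNJ_cross_norm_ge (X Y Z : normedModType K) (nT : tensor X Y -> \bar R)
    (i : {linear tensor X Y -> Z}) (V W : lmodType K) (nV : V -> R) (nW : W -> R) m :
  (exists x : X, x != 0) -> (exists y : Y, y != 0) -> (1 <= m)%N ->
  (forall x y, nT (tens x y) = (rnorm re x * rnorm re y)%:E) ->
  (forall w, (rnorm re (i w))%:E = nT w) ->
  abs_norm nV -> abs_norm nW ->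
  (forall (c : R) (e : cube m -> V) (e' : cube m -> W) (s t s' t' : R), 0 <= c ->
    (forall x y : Z, rnorm re (x + y) ^+ 2 + rnorm re (x - y) ^+ 2 <=
      2 * c * (rnorm re x ^+ 2 + rnorm re y ^+ 2)) ->
    ell2_frame re nV e s t -> ell2_frame re nW e' s' t' ->
    2 ^+ m <= c ^+ m * ((t * s) * (t' * s')) ^+ 2) ->
  (Order.max (Order.max (CNJ re X) (CNJ re Y))
     (eta_term m (eta_norm re nV (2 ^ m)) (eta_norm re nW (2 ^ m))) <= CNJ re Z)%E.
Proof.
move=> [x0 x0n] [y0 y0n] m1 cross iso nVn nWn frame_bound.
have tens_norm x y : rnorm re (i (tens x y)) = rnorm re x * rnorm re y.
  by have := iso (tens x y); rewrite cross => -[].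
have leX : (CNJ re X <= CNJ re Z)%E.
  apply: (CNJ_le_scaled_embedding hre (j := fun x => i (tens x y0)) (k := rnorm re y0)).
  - by move=> x y; rewrite tensDl linearD.
  - by move=> x y; rewrite -scaleN1r tensDl tensZl scaleN1r linearB.
  - by rewrite (rnorm_gt0 hre).
  - by move=> x; rewrite tens_norm mulrC.
have leY : (CNJ re Y <= CNJ re Z)%E.
  apply: (CNJ_le_scaled_embedding hre (j := fun y => i (tens x0 y)) (k := rnorm re x0)).
  - by move=> x y; rewrite tensDr linearD.
  - by move=> x y; rewrite -scaleN1r tensDr tensZr scaleN1r linearB.
  - by rewrite (rnorm_gt0 hre).
  - by move=> x; rewrite tens_norm.
rewrite !ge_max leX leY /=.
have Z1 : (1 <= CNJ re Z)%E by exact: le_trans (CNJ_ge1 hre x0n) leX.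
case EZ: (CNJ re Z) Z1 => [c||] // => [c1|_]; last by rewrite leey.
have c0 : 0 < c by rewrite lee_fin in c1; exact: lt_le_trans ltr01 c1.
apply: eta_term_le => //; try exact: eta_norm_ge0.
apply: eta_norm_mul_ge => //; first by rewrite powR_gt0 // divr_gt0.
move=> e e' s t s' t' fr fr'; apply: powR_half_le => //.
  by case: fr fr' => s0 t0 _ _ [s'0 t'0 _ _]; rewrite !mulr_ge0 // ltW.
apply: frame_bound fr fr'; first exact: ltW.
exact: (CNJ_parallelogram hre EZ).
Qed.

End Main.

Theorem theorem5p6 (R : realType) (K : numFieldType) (re : K -> R)
    (hK : scalar_field re) (X Y : completeNormedModType K)
    (hX : exists x : X, x != 0) (hY : exists y : Y, y != 0)
    (m : nat) (hm : (1 <= m)%N) :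
  (forall (Z : completeNormedModType K) (i : {linear tensor X Y -> Z}),
    is_completion (@injective_norm R K re X Y) re i ->
    (Order.max (Order.max (CNJ re X) (CNJ re Y))
       (eta_term m (eta re X (2 ^ m)) (eta re Y (2 ^ m))) <= CNJ re Z)%E) /\
  (forall (Z : completeNormedModType K) (i : {linear tensor X Y -> Z}),
    is_completion (@projective_norm R K re X Y) re i ->
    (Order.max (Order.max (CNJ re X) (CNJ re Y))
       (eta_term m (eta_dual re X (2 ^ m)) (eta_dual re Y (2 ^ m)))
     <= CNJ re Z)%E) /\
  (eta re X 2 != +oo%E -> eta re Y 2 != +oo%E ->
    eta_term 1 (eta re X 2) (eta re Y 2)
    = (2 / (fine (eta re X 2) ^+ 2 * fine (eta re Y 2) ^+ 2))%:E) /\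
  (eta_dual re X 2 != +oo%E -> eta_dual re Y 2 != +oo%E ->
    eta_term 1 (eta_dual re X 2) (eta_dual re Y 2)
    = (2 / (fine (eta_dual re X 2) ^+ 2 * fine (eta_dual re Y 2) ^+ 2))%:E).
Proof.
have [iota hre] := scalar_field_real_part hK.
have nX := rnorm_abs_norm hre; have nD := dual_norm_abs_norm hre.
split; [|split; [|split]].
- move=> Z i [iso _]; apply: (CNJ_cross_norm_ge hre hX hY hm _ iso) => //.
    by move=> x y; exact: (injective_norm_tens hre).
  by move=> c e e' s t s' t' c0 para; exact: (injective_frame_bound hre para c0 hK iso).
- move=> Z i [iso _]; apply: (CNJ_cross_norm_ge hre hX hY hm _ iso) => //.
    by move=> x y; exact: (projective_norm_tens hre).
  by move=> c e e' s t s' t' c0 para; exact: (projective_frame_bound hre para c0 iso).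
- by apply: eta_term1E; exact: (eta_norm_ge0 hre 1).
- by apply: eta_term1E; exact: (eta_norm_ge0 hre 1).
Qed.
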